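(* Let $p$ be a prime, $m,n$ positive integers, and $\hat f=\sum_i\bar a_iy^i\in\mathbb Z_{p^n}[y]$ a monic basic irreducible polynomial of degree $m$ (i.e. $\hat f$ is irreducible modulo $p$), with its nonzero coefficients represented by integers $1\le a_i\le p^n-1$; let $R=\mathbb Z_{p^n}[y]/\langle\hat f\rangle$ be the corresponding Galois ring, $A=R[x_1,\ldots,x_r]$, $T=\mathbb Z[y,x_1,\ldots,x_r]$ and $f=\sum_ia_iy^i\in T$. Let $\overline J$ be the ideal of $A$ generated by nonzero polynomials $\overline f_1,\ldots,\overline f_t$, where $\overline f_i=\sum_j\overline h_{ij}x^{\alpha(j)}$ with nonzero $\overline h_{ij}\in R$ represented by $\hat h_{ij}=\sum_k\bar a^{ij}_ky^k\in\mathbb Z_{p^n}[y]$, the nonzero coefficients being represented by integers $1\le a^{ij}_k\le p^n-1$. Put $h_{ij}=\sum_ka^{ij}_ky^k$, $f_i=\sum_jh_{ij}x^{\alpha(j)}$, $S=\{f_1,\ldots,f_t,f,p^n\}$ and $J=\langle S\rangle\subseteq T$. If, with respect to an elimination ordering $\prec$ on the monomials of $T$ with the $x$ variables larger than $y$, $\mathcal G=\{g_1,\ldots,g_l\}$ is a strong Gröbner basis of $J$ constructed by the S-polynomial algorithm over a PID (recalled in the context) with initial input $S$ in $T$, then: (i) the set $$\overline{\mathcal G}=\{\overline g_k=\varphi\psi(g_k)\mid g_k\in\mathcal G,\ g_k\notin\{f,p^n\}\}=\varphi\psi(\mathcal G)-\{0\}$$ is a Gröbner basis for $\overline J$ in $A$,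 where $\varphi$ and $\psi$ are the canonical ring epimorphisms $$\mathbb Z[y,x_1,\ldots,x_r]\xrightarrow{\ \psi\ }\mathbb Z_{p^n}[y,x_1,\ldots,x_r]=(\mathbb Z_{p^n}[y])[x_1,\ldots,x_r]\xrightarrow{\ \varphi\ }(\mathbb Z_{p^n}[y]/\langle\hat f\rangle)[x_1,\ldots,x_r];$$ (ii) for each $g_k\in\mathcal G-\{f,p^n\}$, the element $\psi(g_k)$ of $(\mathbb Z_{p^n}[y])[x_1,\ldots,x_r]$ has a representation $\psi(g_k)=g_k'+g_k''$ with $g_k'=\sum_qh_{kq}x^{\alpha(q)}$, $h_{kq}\notin\langle\hat f\rangle$ for all $q$, and $g_k''=\sum_\ell h_{k\ell}x^{\alpha(\ell)}$, $h_{k\ell}\in\langle\hat f\rangle$ for all $\ell$, and such a representation can be algorithmically determined; thereby each element of $\overline{\mathcal G}$ has a representation $\overline g_k=\varphi(g_k')=\sum_q\overline h_{kq}x^{\alpha(q)}$ with all $\overline h_{kq}\neq0$; (iii) all basic applications of the Gröbner basis $\overline{\mathcal G}$ at the level of $A$ can be realized by using the strong Gröbner basis $\mathcal G$ at the level of $T$; that is, results of the following kind hold (for a polynomial $\overline u$ over $R$, $u$ denotes the polynomial with integer coefficients obtained from $\overline u$ in the same way as $f_i$ is obtained from $\overline f_i$): (a) (ideal membership) for $0\ne\overline u\in A$: $\overline u\in\overline J$ if and only if $u\in J$, if and only if $u$ reduces to $0$ under division by $\mathcal G$ in $T$, i.e. $u=\sum_iH_ig_i$ with $H_i\in T$, $g_i\in\mathcal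 G$ and $\mathbf{LM}(H_i)\mathbf{LM}(g_i)\preceq\mathbf{LM}(u)$ for all $H_i\ne0$; (b) a complete set of coset representatives for $A/\overline J$ can be obtained by constructing a complete set of coset representatives for $T/J$, provided the coefficient ring of $T$ has effective coset representatives; (c) (elimination) if further variables $z_1,\ldots,z_k$ are adjoined to $A$ and $T$ and the ordering used is an elimination ordering with the $z$ variables larger than the $x$ variables (and the $z$ and $x$ variables larger than $y$), then $\overline{\mathcal G}\cap R[x_1,\ldots,x_r]$ is a Gröbner basis for $\overline J\cap R[x_1,\ldots,x_r]$; (d) for ideals $\overline J_1=\langle\overline u_1,\ldots,\overline u_a\rangle$, $\overline J_2=\langle\overline v_1,\ldots,\overline v_b\rangle$ of $A$, a generating set (indeed a Gröbner basis) of $\overline J_1\cap\overline J_2$ can be obtained by constructing a Gröbner basis for the ideal $\langle zu_1,\ldots,zu_a,(1-z)v_1,\ldots,(1-z)v_b,f,p^n\rangle$ of $T[z]$; the ideal quotient $\overline J_1:\overline J_2=\bigcap_j\overline J_1:\langle\overline v_j\rangle$ can be obtained by constructing in this way generating sets of the $\overline J_1\cap\langle\overline v_j\rangle$; and the kernel of an $R$-algebra homomorphism $R[z_1,\ldots,z_k]\to A$, $z_i\mapsto\overline u_i$, can be obtained by constructing a Gröbner basis for the ideal $\langle z_1-u_1,\ldots,z_k-u_k,f,p^n\rangle$ of $T[z_1,\ldots,z_k]$; (e) a generating set for the syzygy module $\mathrm{Syz}_A(\overline f_1,\ldots,\overline f_t)$ can be obtained by working out the necessary data in $T$ ($\mathcal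 G$ together with a homogeneous generating set of the syzygy module of the leading terms of its elements) and passing to $A$.
   Context: $\mathbb Z_{p^n}=\mathbb Z/p^n\mathbb Z$; $\bar a$ denotes the class of $a\in\mathbb Z$, and $\overline h$ denotes the class in $R$ of $h\in\mathbb Z_{p^n}[y]$. The elimination ordering $\prec$ is a monomial ordering with $x^\alpha y^b\prec x^{\alpha'}y^{b'}$ iff $x^\alpha\prec x^{\alpha'}$, or $x^\alpha=x^{\alpha'}$ and $y^b\prec y^{b'}$; its restriction to $x$-monomials is the ordering used in $A$. For a nonzero polynomial $f$ over a commutative coefficient ring, written with nonzero coefficients, $\mathbf{LM}(f)$ is its largest monomial, $\mathbf{LC}(f)$ the corresponding coefficient, $\mathbf{LT}(f)=\mathbf{LC}(f)\mathbf{LM}(f)$. A finite set $\mathcal G$ of nonzero elements of an ideal $J$ is a Gröbner basis of $J$ if $\langle\mathbf{LT}(J)\rangle=\langle\mathbf{LT}(\mathcal G)\rangle$; it is a strong Gröbner basis if for each $0\neq f\in J$ there are a coefficient $\lambda$, a monomial $u$ and $g\in\mathcal G$ with $\mathbf{LT}(f)=\lambda u\mathbf{LT}(g)$. In $T$ coefficients are in $\mathbb Z$ and monomials are $x^\alpha y^b$; in $A$ coefficients are in $R$ and monomials are $x^\alpha$. Reduction: $f\ne0$ reduces in one step modulo a finite set $F$ of nonzero polynomials of $T$ to $f-\sum_j\lambda_ju_jf_{i_j}$ if $f_{i_j}\in F$, $\lambda_j\in\mathbb Z-\{0\}$, $u_j$ are monomials, $\mathbf{LM}(f)=u_j\mathbf{LM}(f_{i_j})$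 for all $j$, and $\mathbf{LT}(f)=\sum_j\lambda_ju_j\mathbf{LT}(f_{i_j})$; $f\neq 0$ is minimal with respect to $F$ if no such step exists. S-polynomial algorithm over a PID with input a finite set $S$: start with $G:=S$; for every pair $f\neq g$ in $G$ (including pairs involving later-added elements) form $\frac{cX}{\mathbf{LT}(f)}f-\frac{cX}{\mathbf{LT}(g)}g$, where $c=\mathrm{lcm}(\mathbf{LC}(f),\mathbf{LC}(g))$ and $X=\mathrm{lcm}(\mathbf{LM}(f),\mathbf{LM}(g))$, reduce it modulo the current $G$ to some $r$ that is $0$ or minimal with respect to $G$, and adjoin $r$ if $r\neq0$; stop when all pairs are processed and output $G$. A ring has effective coset representatives if for each ideal one can find a complete set of coset representatives and, for each element, its representative in that set. $\mathrm{Syz}_A(\overline f_1,\ldots,\overline f_t)=\{(a_i)\in A^t\mid\sum a_i\overline f_i=0\}$, and $\overline J_1:\overline J_2=\{\overline q\in A\mid\overline q\,\overline J_2\subseteq\overline J_1\}$. *)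

(* Defs.v *)
From HB Require Import structures.
From mathcomp Require Import all_boot all_order all_algebra.
From mathcomp Require Export mpoly.

Set Implicit Arguments.
Unset Strict Implicit.
Unset Printing Implicit Defensive.

Import GRing.Theory.
Local Open Scope ring_scope.

(* Ideals of a commutative ring are predicates C -> Prop. *)

Definition ideal_gen (C : comNzRingType) (S : C -> Prop) (x : C) : Prop :=
  exists s : seq (C * C),
    (forall c, c \in s -> S c.2) /\ x = \sum_(c <- s) c.1 * c.2.

Definition ideal_of (C : comNzRingType) (s : seq C) : C -> Prop :=
  ideal_gen (fun x => x \in s).

Definition colon (C : comNzRingType) (J1 J2 : C -> Prop) (q : C) : Prop :=
  forall w, J2 w -> J1 (q * w).

Definition complete_reps (C : comNzRingType) (J D : C -> Prop) : Prop :=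
  forall v, exists! c, D c /\ J (v - c).

(* Ideals are given by finite generating lists; [rep s a] is the chosen
   representative of [a] modulo the ideal generated by [s]. *)
Definition effective_reps (C : comNzRingType) (rep : seq C -> C -> C) : Prop :=
  forall s : seq C,
    (forall a, ideal_of s (a - rep s a)) /\
    (forall a b, ideal_of s (a - b) -> rep s a = rep s b).

Definition mod_span (C : comNzRingType) (k : nat)
    (S : 'rV[C]_k -> Prop) (v : 'rV[C]_k) : Prop :=
  exists s : seq (C * 'rV[C]_k),
    (forall c, c \in s -> S c.2) /\ v = \sum_(c <- s) c.1 *: c.2.

(* Monomial orderings; [le] is the non-strict ordering. *)

Definition mlt (n : nat) (le : rel 'X_{1..n}) (m1 m2 : 'X_{1..n}) : bool :=
  (m1 != m2) && le m1 m2.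

Record monomial_order (n : nat) (le : rel 'X_{1..n}) : Prop := MonomialOrder {
  mo_refl : reflexive le;
  mo_anti : antisymmetric le;
  mo_trans : transitive le;
  mo_total : total le;
  mo_add : forall m m1 m2, le m1 m2 -> le (m1 + m)%MM (m2 + m)%MM;
  mo_wf : well_founded (fun m1 m2 => mlt le m1 m2)
}.

(* The variables of index set 'I_(a + b) are split into two blocks, and
   [mcat m1 m2] is the product of a monomial in the first block and a monomial
   in the second one. *)
Definition mcat (a b : nat) (m1 : 'X_{1..a}) (m2 : 'X_{1..b}) :
    'X_{1..(a + b)%N} :=
  [multinom match split i with inl j => m1 j | inr j => m2 j end | i < (a + b)%N].

Definition order_l (a b : nat) (le : rel 'X_{1..(a + b)%N}) : rel 'X_{1..a} :=
  fun m m' => le (mcat m 0%MM) (mcat m' 0%MM).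

Definition order_r (a b : nat) (le : rel 'X_{1..(a + b)%N}) : rel 'X_{1..b} :=
  fun m m' => le (mcat 0%MM m) (mcat 0%MM m').

(* The first block of variables is larger than the second one. *)
Definition elim_order (a b : nat) (le : rel 'X_{1..(a + b)%N}) : Prop :=
  forall (m1 m1' : 'X_{1..a}) (m2 m2' : 'X_{1..b}),
    mlt le (mcat m1 m2) (mcat m1' m2') =
    mlt (order_l le) m1 m1' || (m1 == m1') && mlt (order_r le) m2 m2'.

(* The monomial 0 (that is, 1 written additively) is the least one, so [LM f] is
   the largest monomial of [f] when [f != 0]; conventionally [LM 0] is 0. *)
Definition LM (n : nat) (le : rel 'X_{1..n}) (C : comNzRingType)
    (f : {mpoly C[n]}) : 'X_{1..n} :=
  foldr (fun m1 m2 => if le m1 m2 then m2 else m1) 0%MM (msupp f).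

Definition LC (n : nat) (le : rel 'X_{1..n}) (C : comNzRingType)
    (f : {mpoly C[n]}) : C := f@_(LM le f).

Definition LT (n : nat) (le : rel 'X_{1..n}) (C : comNzRingType)
    (f : {mpoly C[n]}) : {mpoly C[n]} := LC le f *: 'X_[LM le f].

Definition groebner (n : nat) (le : rel 'X_{1..n}) (C : comNzRingType)
    (J : {mpoly C[n]} -> Prop) (G : seq {mpoly C[n]}) : Prop :=
  (forall g, g \in G -> g != 0 /\ J g) /\
  (forall h,
     ideal_gen (fun w => exists f, [/\ J f, f != 0 & w = LT le f]) h <->
     ideal_of [seq LT le g | g <- G] h).

Definition strong_groebner (n : nat) (le : rel 'X_{1..n}) (C : comNzRingType)
    (J : {mpoly C[n]} -> Prop) (G : seq {mpoly C[n]}) : Prop :=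
  (forall g, g \in G -> g != 0 /\ J g) /\
  (forall f, f != 0 -> J f ->
     exists (c : C) (u : 'X_{1..n}),
       exists2 g, g \in G & LT le f = c *: ('X_[u] * LT le g)).

(* Division: [w] is a combination of [G] with quotients [H], without
   cancellation of leading terms (all quotients of 0 are 0). *)
Definition std_rep (n : nat) (le : rel 'X_{1..n}) (C : comNzRingType)
    (G : seq {mpoly C[n]}) (w : {mpoly C[n]})
    (H : 'rV[{mpoly C[n]}]_(size G)) : Prop :=
  w = \sum_(i < size G) H ord0 i * G`_i /\
  (forall i, H ord0 i != 0 ->
     w != 0 /\ le (LM le (H ord0 i) + LM le G`_i)%MM (LM le w)).

(* A list of triples (c, u, g) stands for the terms c * 'X_[u] * g. *)
Definition red_step (n : nat) (le : rel 'X_{1..n}) (F : seq {mpoly int[n]})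
    (f h : {mpoly int[n]}) : Prop :=
  f != 0 /\
  exists s : seq (int * 'X_{1..n} * {mpoly int[n]}),
    [/\ forall c, c \in s ->
          [/\ c.2 \in F, c.1.1 != 0 & LM le f = (c.1.2 + LM le c.2)%MM],
        LT le f = \sum_(c <- s) c.1.1 *: ('X_[c.1.2] * LT le c.2)
      & h = f - \sum_(c <- s) c.1.1 *: ('X_[c.1.2] * c.2)].

Inductive red_star (n : nat) (le : rel 'X_{1..n}) (F : seq {mpoly int[n]})
    (f : {mpoly int[n]}) : {mpoly int[n]} -> Prop :=
| red_refl : red_star le F f f
| red_trans h r : red_star le F f h -> red_step le F h r -> red_star le F f r.

Definition minimal (n : nat) (le : rel 'X_{1..n}) (F : seq {mpoly int[n]})
    (f : {mpoly int[n]}) : Prop :=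
  f != 0 /\ forall h, ~ red_step le F f h.

Definition spoly (n : nat) (le : rel 'X_{1..n}) (f g : {mpoly int[n]}) :
    {mpoly int[n]} :=
  let c := lcmz (LC le f) (LC le g) in
  let X := mlcm (LM le f) (LM le g) in
  (c %/ LC le f)%Z *: ('X_[(X - LM le f)%MM] * f)
  - (c %/ LC le g)%Z *: ('X_[(X - LM le g)%MM] * g).

(* [spoly_run le S G P]: starting from [S], the algorithm can reach the current
   set [G] having processed exactly the pairs in [P]. *)
Inductive spoly_run (n : nat) (le : rel 'X_{1..n}) (S : seq {mpoly int[n]}) :
    seq {mpoly int[n]} -> seq ({mpoly int[n]} * {mpoly int[n]}) -> Prop :=
| spoly_start : spoly_run le S S [::]
| spoly_next G P f g r :
    spoly_run le S G P ->
    f \in G -> g \in G -> f != g -> (f, g) \notin P -> (g, f) \notin P ->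
    red_star le G (spoly le f g) r -> r = 0 \/ minimal le G r ->
    spoly_run le S (if r == 0 then G else rcons G r) ((f, g) :: P).

Definition spoly_output (n : nat) (le : rel 'X_{1..n})
    (S G : seq {mpoly int[n]}) : Prop :=
  exists2 P, spoly_run le S G P &
    forall f g, f \in G -> g \in G -> f != g -> (f, g) \in P \/ (g, f) \in P.

(* Reduction modulo p of the coefficients of a polynomial over Z/p^n. *)
Definition red_mod_p (p n : nat) (h : {poly 'Z_(p ^ n)}) : {poly 'F_p} :=
  map_poly (fun c : 'Z_(p ^ n) => (nat_of_ord c)%:R) h.

(* Z[y, x_1, ..., x_r]: the variables of index [lshift 1 i] are the x_i, and
   y is the last variable. *)
Notation Zyx r := {mpoly int[(r + 1)%N]}.

Definition psi (q r : nat) : Zyx r -> {mpoly {poly 'Z_q}[r]} :=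
  mmap (@mpolyC r {poly 'Z_q} \o intmul 1)
       (fun i => match split i with
                 | inl j => 'X_j
                 | inr _ => ('X : {poly 'Z_q})%:MP
                 end).

Definition phi (q r : nat) (fhat : {poly 'Z_q}) :
    {mpoly {poly 'Z_q}[r]} -> {mpoly {poly %/ fhat}[r]} :=
  map_mpoly (in_qpoly fhat).

Definition phipsi (q r : nat) (fhat : {poly 'Z_q}) (g : Zyx r) :
    {mpoly {poly %/ fhat}[r]} := phi fhat (psi q g).

(* The polynomial with integer coefficients in 0, ..., q - 1 that represents
   a polynomial over Z/q. *)
Definition liftZ (q r : nat) (v : {mpoly {poly 'Z_q}[r]}) : Zyx r :=
  \sum_(m <- msupp v) \sum_(k < size v@_m)
    (nat_of_ord (v@_m)`_k)%:Z *: 'X_[mcat m (U_(ord0 : 'I_1) *+ k)%MM].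

(* [v] collects representatives in (Z/q)[y], not necessarily reduced modulo
   [fhat], of the nonzero coefficients of [vbar]. *)
Definition represents (q r : nat) (fhat : {poly 'Z_q})
    (v : {mpoly {poly 'Z_q}[r]}) (vbar : {mpoly {poly %/ fhat}[r]}) : Prop :=
  phi fhat v = vbar /\ (forall m, v@_m != 0 -> vbar@_m != 0).

Definition moduli (q r : nat) (fhat : {poly 'Z_q}) : seq (Zyx r) :=
  [:: liftZ (fhat%:MP : {mpoly {poly 'Z_q}[r]}); q%:R].

Definition input_set (q r t : nat) (fhat : {poly 'Z_q})
    (fh : 'I_t -> {mpoly {poly 'Z_q}[r]}) : seq (Zyx r) :=
  [seq liftZ (fh i) | i <- enum 'I_t] ++ moduli r fhat.

Definition bar_set (q r : nat) (fhat : {poly 'Z_q}) (G : seq (Zyx r)) :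
    seq {mpoly {poly %/ fhat}[r]} :=
  [seq v <- [seq phipsi fhat g | g <- G] | v != 0].

(* [v = split_out fhat v + split_in fhat v], where the terms are distributed by
   testing the divisibility of their coefficients by the monic [fhat]. *)
Definition split_out (q r : nat) (fhat : {poly 'Z_q})
    (v : {mpoly {poly 'Z_q}[r]}) : {mpoly {poly 'Z_q}[r]} :=
  \sum_(m <- msupp v | Pdiv.Ring.rmodp v@_m fhat != 0) v@_m *: 'X_[m].

Definition split_in (q r : nat) (fhat : {poly 'Z_q})
    (v : {mpoly {poly 'Z_q}[r]}) : {mpoly {poly 'Z_q}[r]} :=
  \sum_(m <- msupp v | Pdiv.Ring.rmodp v@_m fhat == 0) v@_m *: 'X_[m].

(* For a monomial m, the ideal of leading coefficients at m is generated by the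
   LC(g) with LM(g) dividing m. A polynomial is totally reduced if each of its
   coefficients is the chosen representative modulo that ideal, the zero coset
   being always represented by 0. *)
Definition lc_gens (n : nat) (le : rel 'X_{1..n}) (G : seq {mpoly int[n]})
    (m : 'X_{1..n}) : seq int :=
  [seq LC le g | g <- G & (LM le g <= m)%MM].

Definition totally_reduced (n : nat) (le : rel 'X_{1..n})
    (rep : seq int -> int -> int) (G : seq {mpoly int[n]})
    (u : {mpoly int[n]}) : Prop :=
  forall m, m \in msupp u ->
    ~ ideal_of (lc_gens le G m) u@_m /\ rep (lc_gens le G m) u@_m = u@_m.

Definition mrename (n n' : nat) (C : comNzRingType) (s : 'I_n -> 'I_n')
    (u : {mpoly C[n]}) : {mpoly C[n']} :=
  u \mPo [tuple 'X_(s i) | i < n].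

(* Z[y, x_1, ..., x_r] -> Z[y, x_1, ..., x_r'] fixing y. *)
Definition embedT (r r' : nat) (s : 'I_r -> 'I_r') : Zyx r -> Zyx r' :=
  mrename (fun i => match split i with
                    | inl j => lshift 1 (s j)
                    | inr j => rshift r' j
                    end).

(* Intersection of a finite set with the subring of polynomials in which the
   first [a] variables do not occur. *)
Definition mright (a b : nat) (m : 'X_{1..(a + b)%N}) : 'X_{1..b} :=
  [multinom m (rshift a i) | i < b].

Definition elim_part (C : comNzRingType) (a b : nat)
    (s : seq {mpoly C[(a + b)%N]}) : seq {mpoly C[b]} :=
  [seq \sum_(m <- msupp v) v@_m *: 'X_[mright m]
     | v <- s & all (fun m : 'X_{1..(a + b)%N} =>
                       [forall i : 'I_a, m (lshift b i) == 0%N]) (msupp v)].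

(* <z u_1, ..., z u_a, (1 - z) v_1, ..., (1 - z) v_b, f, q> in Z[y, z, x]. *)
Definition inter_gens (q r a b : nat) (fhat : {poly 'Z_q})
    (uh : 'I_a -> {mpoly {poly 'Z_q}[r]}) (vh : 'I_b -> {mpoly {poly 'Z_q}[r]}) :
    seq (Zyx (1 + r)) :=
  let z : Zyx (1 + r) := 'X_(lshift 1 (lshift r ord0)) in
  [seq z * embedT (@rshift 1 r) (liftZ (uh i)) | i <- enum 'I_a]
  ++ [seq (1 - z) * embedT (@rshift 1 r) (liftZ (vh j)) | j <- enum 'I_b]
  ++ moduli (1 + r) fhat.

(* <z_1 - u_1, ..., z_k - u_k, f, q> in Z[y, x, z]. *)
Definition ker_gens (q r k : nat) (fhat : {poly 'Z_q})
    (uh : 'I_k -> {mpoly {poly 'Z_q}[r]}) : seq (Zyx (r + k)) :=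
  [seq 'X_(lshift 1 (rshift r i)) - embedT (@lshift r k) (liftZ (uh i))
     | i <- enum 'I_k]
  ++ moduli (r + k) fhat.

Definition gcol (C : comNzRingType) (G : seq C) : 'cV[C]_(size G) :=
  \col_(i < size G) G`_i.

Definition Fcol (q r t : nat) (fhat : {poly 'Z_q})
    (fh : 'I_t -> {mpoly {poly 'Z_q}[r]}) : 'cV[Zyx r]_(t + 2) :=
  col_mx (\col_(i < t) liftZ (fh i)) (\col_(j < 2) (moduli r fhat)`_j).

(* A syzygy (h_i) of the leading terms of [G] is homogeneous if, for some
   monomial X, every nonzero h_i is a term with h_i * LM(g_i) in degree X. *)
Definition homogeneous (n : nat) (le : rel 'X_{1..n}) (C : comNzRingType)
    (G : seq {mpoly C[n]}) (h : 'rV[{mpoly C[n]}]_(size G)) : Prop :=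
  exists X : 'X_{1..n}, forall i, h ord0 i != 0 ->
    exists (c : C) (u : 'X_{1..n}),
      h ord0 i = c *: 'X_[u] /\ (u + LM le G`_i)%MM = X.

(* [B] is a finite homogeneous generating set of the syzygies of the leading
   terms of [G]; [a h] are the quotients in the division by [G] of the
   combination given by [h]; [M] and [N] are transition matrices between [G]
   and the generators [F]. *)
Record syz_data (n : nat) (le : rel 'X_{1..n}) (C : comNzRingType)
    (G : seq {mpoly C[n]}) (s : nat) (F : 'cV[{mpoly C[n]}]_s)
    (B : seq 'rV[{mpoly C[n]}]_(size G))
    (a : 'rV[{mpoly C[n]}]_(size G) -> 'rV[{mpoly C[n]}]_(size G))
    (M : 'M[{mpoly C[n]}]_(size G, s)) (N : 'M[{mpoly C[n]}]_(s, size G)) :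
    Prop := SyzData {
  sd_homog : forall h, h \in B -> homogeneous le h;
  sd_gen : forall v,
    v *m (\col_(i < size G) LT le G`_i) = 0 <-> mod_span (fun h => h \in B) v;
  sd_div : forall h, h \in B -> std_rep le (\sum_(i < size G) h ord0 i * G`_i) (a h);
  sd_M : gcol G = M *m F;
  sd_N : F = N *m gcol G
}.

(* The syzygies of F are generated by the (h - a h) M and the rows of 1 - N M;
   take their first t components and pass to A. *)
Definition syz_gens (q r t : nat) (fhat : {poly 'Z_q}) (G : seq (Zyx r))
    (B : seq 'rV[Zyx r]_(size G)) (a : 'rV[Zyx r]_(size G) -> 'rV[Zyx r]_(size G))
    (M : 'M[Zyx r]_(size G, t + 2)) (N : 'M[Zyx r]_(t + 2, size G)) :
    seq 'rV[{mpoly {poly %/ fhat}[r]}]_t :=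
  [seq map_mx (phipsi fhat) (lsubmx v)
     | v <- [seq (h - a h) *m M | h <- B]
            ++ [seq row i (1%:M - N *m M) | i <- enum 'I_(t + 2)%N]].

(* Main.v *)
(* The map phipsi is onto with kernel <f, q>, which J contains, so J is the full
   preimage of Jbar. Every nonzero element of the Galois ring R divides, and is
   divisible by, some power p^i with i < n. Hence a nonzero w in Jbar can be
   multiplied by a constant of R so as to make its leading coefficient p^i; its
   canonical lift to J then has leading term p^i x^a, free of y. A Groebner basis
   of J can only reduce this term by elements whose leading monomials are free of
   y, and the leading terms of those elements project to leading terms over R.
   Apart from f and q, no output of the algorithm vanishes in A, because {f, q}
   reduces every nonzero element of <f, q> and the algorithm only adjoins
   elements that are minimal with respect to a set containing f and q.

   The applications follow by combining this with the classical arguments for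
   elimination, for the ideals <z u, (1 - z) v> and <z_i - u_i>, and with
   Schreyer's theorem on syzygies. *)

Require Import Defs.
From HB Require Import structures.
From mathcomp Require Import all_boot all_order all_algebra.

Set Implicit Arguments.
Unset Strict Implicit.
Unset Printing Implicit Defensive.

Import GRing.Theory.
Local Open Scope ring_scope.

(** * Ideals *)

(** The obstacle is that leading terms do not commute with the projection T -> A. If LM(g) = x^a y^b
    with b > 0, the coefficient of x^a in the image of g is a whole polynomial in y taken modulo
    [fhat]; its leading coefficient in y says little about it as an element of R, and it may even
    vanish there. Commutation is available when b = 0, and this is what the normalisation to p^i
    buys: for i < n it is a constant smaller than p^n, hence its own integer representative, whereas
    a general element of R lifts to a polynomial in y. Membership of a term in an ideal of leading
    terms is handled throughout as a linear relation between leading coefficients ([term_comb]),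
    which makes sense over any commutative ring. The comparison is made for any ideals J and Jb such
    that J is the preimage of Jb, in any number of variables. It therefore also serves the ideals
    with extra variables: y disappears in the passage to A, and the extra variables are eliminated
    over R. The existence of the syzygy data over Z rests on the Smith normal form and on the least
    common multiples of sets of leading monomials. *)

Section Ideals.

Variable C : comNzRingType.
Implicit Types (S J : C -> Prop).

Record is_ideal J : Prop := IsIdeal {
  ideal0 : J 0;
  idealD : forall [a b : C], J a -> J b -> J (a + b);
  idealM : forall [c a : C], J a -> J (c * a)
}.

Lemma idealN J a : is_ideal J -> J a -> J (- a).
Proof. by move=> idJ Ja; rewrite -mulN1r; apply: idealM. Qed.

Lemma idealB J a b : is_ideal J -> J a -> J b -> J (a - b).
Proof. by move=> idJ Ja Jb; apply: idealD => //; apply: idealN. Qed.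

Lemma ideal_sum J (I : Type) (s : seq I) (P : pred I) F :
  is_ideal J -> (forall i, P i -> J (F i)) -> J (\sum_(i <- s | P i) F i).
Proof.
move=> idJ JF; elim/big_ind: _ => //; first exact: ideal0.
by move=> a b; apply: idealD.
Qed.

Lemma ideal_gen_ideal S : is_ideal (ideal_gen S).
Proof.
split.
- by exists [::]; rewrite big_nil.
- move=> _ _ [s1 [S1 ->]] [s2 [S2 ->]]; exists (s1 ++ s2).
  by rewrite big_cat; split=> // c; rewrite mem_cat => /orP[/S1|/S2].
- move=> a _ [s [Ss ->]]; exists [seq (a * c.1, c.2) | c <- s].
  rewrite big_map mulr_sumr; split=> [c /mapP[d /Ss ? ->] //|].
  by apply: eq_bigr => c _; rewrite mulrA.
Qed.

Lemma ideal_gen_mem S x : S x -> ideal_gen S x.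
Proof.
move=> Sx; exists [:: (1, x)]; rewrite big_seq1 mul1r; split=> // c.
by rewrite inE => /eqP->.
Qed.

(** The induction principle for membership; later J is typically the preimage of an ideal under a
    morphism, or a kernel. *)
Lemma ideal_gen_min S J :
  is_ideal J -> (forall x, S x -> J x) -> forall x, ideal_gen S x -> J x.
Proof.
move=> idJ SJ _ [s [Ss ->]]; rewrite big_seq_cond; apply: ideal_sum => // c.
by rewrite andbT => /Ss/SJ; apply: idealM.
Qed.

Lemma ideal_of_ideal (s : seq C) : is_ideal (ideal_of s).
Proof. exact: ideal_gen_ideal. Qed.

Lemma ideal_of_mem (s : seq C) x : x \in s -> ideal_of s x.
Proof. exact: ideal_gen_mem. Qed.

Lemma ideal_of_min (s : seq C) J :
  is_ideal J -> (forall x, x \in s -> J x) -> forall x, ideal_of s x -> J x.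
Proof. exact: ideal_gen_min. Qed.

(** A normal form for certificates of membership, with one coefficient per position of the list;
    this is the shape used by [std_rep] and [term_comb]. *)
Lemma ideal_ofP (s : seq C) x :
  ideal_of s x <-> exists c : 'I_(size s) -> C, x = \sum_i c i * s`_i.
Proof.
split; last first.
  case=> c ->; apply: ideal_sum (ideal_of_ideal s) _ => i _.
  by apply: (idealM (ideal_of_ideal s)); apply/ideal_of_mem/mem_nth.
apply: (@ideal_of_min s (fun x => exists c : 'I_(size s) -> C, x = \sum_i c i * s`_i)).
  split.
  - by exists (fun _ => 0); rewrite big1 // => i _; rewrite mul0r.
  - move=> _ _ [c ->] [d ->]; exists (fun i => c i + d i).
    by rewrite -big_split; apply: eq_bigr => i _; rewrite mulrDl.
  - move=> a _ [c ->]; exists (fun i => a * c i).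
    by rewrite mulr_sumr; apply: eq_bigr => i _; rewrite mulrA.
move=> {}x; rewrite -index_mem => lt_x.
exists (fun i : 'I_(size s) => (i == Ordinal lt_x)%:R).
rewrite (bigD1 (Ordinal lt_x)) //= eqxx mul1r big1 ?addr0 => [|i /negPf->].
  by rewrite nth_index // -index_mem.
by rewrite mul0r.
Qed.

Lemma ideal_of1P (a x : C) : ideal_of [:: a] x <-> exists c, x = c * a.
Proof.
split=> [/ideal_ofP[c ->]|[c ->]]; last first.
  by apply: (idealM (ideal_of_ideal _)); apply: ideal_of_mem; rewrite inE.
by exists (c ord0); rewrite big_ord1.
Qed.

Lemma ideal_of_sub (s1 s2 : seq C) :
  (forall x, x \in s1 -> ideal_of s2 x) -> forall x, ideal_of s1 x -> ideal_of s2 x.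
Proof. exact: ideal_of_min (ideal_of_ideal s2). Qed.

End Ideals.

Lemma ideal_preim (C D : comNzRingType) (f : {rmorphism C -> D}) (J : D -> Prop) :
  is_ideal J -> is_ideal (fun x => J (f x)).
Proof.
move=> idJ; split; first by rewrite rmorph0; apply: ideal0.
- by move=> a b Ja Jb; rewrite rmorphD; apply: idealD.
- by move=> c a Ja; rewrite rmorphM; apply: idealM.
Qed.

(** * Monomial orders and leading terms *)

Section MonomialOrders.

Variables (n : nat) (le : rel 'X_{1..n}) (le_mo : monomial_order le).
Implicit Types m : 'X_{1..n}.
Notation lt := (mlt le).

Lemma mo_ltW m1 m2 : lt m1 m2 -> le m1 m2.
Proof. by case/andP. Qed.

Lemma mo_ltn m : lt m m = false.
Proof. by rewrite /mlt eqxx. Qed.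

Lemma mo_ltNge m1 m2 : lt m1 m2 = ~~ le m2 m1.
Proof.
rewrite /mlt; have := mo_total le_mo m1 m2; have := @mo_anti _ _ le_mo m1 m2.
have [->|ne] := eqVneq m1 m2; first by rewrite (mo_refl le_mo).
by case: (le m1 m2) (le m2 m1) => -[] // /(_ isT) /eqP; rewrite (negPf ne).
Qed.

Lemma mo_leNgt m1 m2 : le m1 m2 = ~~ lt m2 m1.
Proof. by rewrite mo_ltNge negbK. Qed.

Lemma mo_le_lt_trans m2 m1 m3 : le m1 m2 -> lt m2 m3 -> lt m1 m3.
Proof.
move=> le12; rewrite !mo_ltNge; apply: contra => le31.
exact: mo_trans le_mo _ _ _ le31 le12.
Qed.

Lemma mo_lt_le_trans m2 m1 m3 : lt m1 m2 -> le m2 m3 -> lt m1 m3.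
Proof.
move=> + le23; rewrite !mo_ltNge; apply: contra => le31.
exact: mo_trans le_mo _ _ _ le23 le31.
Qed.

Lemma mo_le_eqVlt m1 m2 : le m1 m2 = (m1 == m2) || lt m1 m2.
Proof.
by rewrite /mlt; case: eqVneq => //= ->; rewrite (mo_refl le_mo).
Qed.

Lemma mo_ltD2r m m1 m2 : lt m1 m2 -> lt (m1 + m)%MM (m2 + m)%MM.
Proof.
by case/andP=> ne le12; rewrite /mlt eqm_add2r ne; apply: mo_add le_mo _ _ _ le12.
Qed.

Lemma mo_leD m1 m2 m3 m4 : le m1 m3 -> le m2 m4 -> le (m1 + m2)%MM (m3 + m4)%MM.
Proof.
move=> le13 le24; apply: mo_trans (mo_add le_mo m2 le13) _ => //.
by rewrite ![(m3 + _)%MM]addmC; apply: mo_add.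
Qed.

Lemma mo_ltleD m1 m2 m3 m4 : lt m1 m3 -> le m2 m4 -> lt (m1 + m2)%MM (m3 + m4)%MM.
Proof.
move=> lt13 le24; apply: mo_lt_le_trans (mo_ltD2r m2 lt13) _.
by apply: mo_leD => //; apply: mo_refl.
Qed.

Lemma mo_leltD m1 m2 m3 m4 : le m1 m3 -> lt m2 m4 -> lt (m1 + m2)%MM (m3 + m4)%MM.
Proof.
by move=> le13 lt24; rewrite addmC [(m3 + _)%MM]addmC; apply: mo_ltleD.
Qed.

(* If m < 0 then m, 2m, 3m, ... is an infinite descending chain. *)
Lemma mo_ge0 m : le 0%MM m.
Proof.
rewrite mo_leNgt; apply/negP => lt_m0.
suff: forall u k, u = (m *+ k)%MM -> False by move/(_ _ 0%N (erefl _)).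
move=> u; elim: (mo_wf le_mo u) => {}u _ IH k Du.
apply: (IH (m *+ k.+1)%MM _ k.+1 (erefl _)).
by rewrite Du mulmS -{2}[(m *+ k)%MM]add0m; apply: mo_ltD2r.
Qed.

Lemma mo_lem m1 m2 : (m1 <= m2)%MM -> le m1 m2.
Proof.
move/submK <-; rewrite -{1}[m1]add0m.
by apply: mo_leD (mo_ge0 _) (mo_refl le_mo _).
Qed.

End MonomialOrders.

Section LeadingMonomials.

Variables (n : nat) (le : rel 'X_{1..n}) (le_mo : monomial_order le).
Variable C : comNzRingType.
Implicit Types (m : 'X_{1..n}) (f g : {mpoly C[n]}).
Notation lt := (mlt le).
Notation LM := (LM le).
Notation LC := (LC le).

(** Degree bounds that remain meaningful for the zero polynomial, where [LM] has only a conventional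
    value. *)
Definition supp_le m f := forall m', m' \in msupp f -> le m' m.
Definition supp_lt m f := forall m', m' \in msupp f -> lt m' m.

Lemma LM_max f m : m \in msupp f -> le m (LM f).
Proof.
rewrite /Defs.LM; elim: (msupp f) => // a s IH; rewrite inE => /orP[/eqP->|/IH le_m] /=.
  by case: ifP => // _; apply: mo_refl.
set b := foldr _ _ _ in le_m *; case: ifPn => // /negP.
by case/orP: (mo_total le_mo a b) => // le_ba _; apply: mo_trans le_mo _ _ _ le_m le_ba.
Qed.

(** The fold in [LM] starts at 0, which could be returned without being a monomial of f; as 0 is the
    least monomial, it can win only against a last monomial that is itself 0. *)
Lemma LM_msupp f : f != 0 -> LM f \in msupp f.
Proof.
rewrite -msupp_eq0 /Defs.LM; elim: (msupp f) => // a s IH _ /=.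
case: s IH => [_|b s /(_ isT) IH]; last by case: ifP => _; rewrite inE ?IH ?eqxx ?orbT.
case: ifP => //=; rewrite ?inE ?eqxx // => le_a0.
by apply/eqP/(mo_anti le_mo); rewrite le_a0 mo_ge0.
Qed.

Lemma LM_uniq f m : m \in msupp f -> supp_le m f -> LM f = m.
Proof.
move=> m_f le_m; apply: (mo_anti le_mo); rewrite LM_max // andbT.
by apply/le_m/LM_msupp; apply: contraTneq m_f => ->; rewrite msupp0.
Qed.

Lemma LC_neq0 f : f != 0 -> LC f != 0.
Proof. by move/LM_msupp; rewrite mcoeff_msupp. Qed.

Lemma supp_le_LM f : supp_le (LM f) f.
Proof. by move=> m; apply: LM_max. Qed.

Lemma supp_ltW m f : supp_lt m f -> supp_le m f.
Proof. by move=> lt_f m' /lt_f/mo_ltW. Qed.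

Lemma supp_le_lt_trans m1 m2 f : lt m1 m2 -> supp_le m1 f -> supp_lt m2 f.
Proof. by move=> lt12 le1 m' /le1; move/(mo_le_lt_trans le_mo); apply. Qed.

Lemma supp_le0 m : supp_le m (0 : {mpoly C[n]}).
Proof. by move=> m'; rewrite msupp0. Qed.

Lemma supp_leD m f g : supp_le m f -> supp_le m g -> supp_le m (f + g).
Proof. by move=> le_f le_g m' /msuppD_le; rewrite mem_cat => /orP[/le_f|/le_g]. Qed.

Lemma supp_leN m f : supp_le m f -> supp_le m (- f).
Proof. by move=> le_f m'; rewrite (perm_mem (msuppN f)) => /le_f. Qed.

Lemma supp_le_sum m (I : Type) (s : seq I) (P : pred I) (F : I -> {mpoly C[n]}) :
  (forall i, P i -> supp_le m (F i)) -> supp_le m (\sum_(i <- s | P i) F i).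
Proof.
move=> le_F; elim/big_ind: _ => //; first exact: supp_le0.
by move=> f g; apply: supp_leD.
Qed.

Lemma supp_lt0 m : supp_lt m (0 : {mpoly C[n]}).
Proof. by move=> m'; rewrite msupp0. Qed.

Lemma supp_ltD m f g : supp_lt m f -> supp_lt m g -> supp_lt m (f + g).
Proof. by move=> lt_f lt_g m' /msuppD_le; rewrite mem_cat => /orP[/lt_f|/lt_g]. Qed.

Lemma supp_lt_sum m (I : Type) (s : seq I) (P : pred I) (F : I -> {mpoly C[n]}) :
  (forall i, P i -> supp_lt m (F i)) -> supp_lt m (\sum_(i <- s | P i) F i).
Proof.
move=> lt_F; elim/big_ind: _ => //; first exact: supp_lt0.
by move=> f g; apply: supp_ltD.
Qed.

Lemma supp_leM m1 m2 f g : supp_le m1 f -> supp_le m2 g -> supp_le (m1 + m2)%MM (f * g).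
Proof.
move=> le_f le_g m /msuppM_le /allpairsP[[a b] /= [/le_f le_a /le_g le_b ->]].
exact: mo_leD.
Qed.

Lemma supp_leZ m c f : supp_le m f -> supp_le m (c *: f).
Proof. by move=> le_f m' /msuppZ_le/le_f. Qed.

Lemma supp_ltZ m c f : supp_lt m f -> supp_lt m (c *: f).
Proof. by move=> lt_f m' /msuppZ_le/lt_f. Qed.

Lemma supp_leX m : supp_le m ('X_[m] : {mpoly C[n]}).
Proof. by move=> m'; rewrite msuppX inE => /eqP->; apply: mo_refl. Qed.

Lemma supp_le_lt m f : supp_le m f -> f@_m = 0 -> supp_lt m f.
Proof.
move=> le_f f_m m' m'f; rewrite /mlt le_f // andbT; apply: contraTneq m'f => ->.
by rewrite mcoeff_msupp f_m eqxx.
Qed.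

(** Well-founded induction on the leading monomial. The bound on the support covers a remainder that
    is 0 without a separate case. *)
Lemma LM_ind (P : {mpoly C[n]} -> Prop) :
  P 0 -> (forall f, f != 0 -> (forall g, supp_lt (LM f) g -> P g) -> P f) ->
  forall f, P f.
Proof.
move=> P0 Pf.
suff Pm m : forall f, supp_lt m f -> P f.
  move=> f; have [->//|f0] := eqVneq f 0.
  by apply: Pf => // g; apply: Pm.
elim: (mo_wf le_mo m) => {}m _ IH f lt_f.
have [->//|f0] := eqVneq f 0.
by apply: Pf => //; apply: IH; apply: lt_f; apply: LM_msupp.
Qed.

Lemma mcoeffXM f u m :
  ('X_[u] * f)@_m = if (u <= m)%MM then f@_(m - u)%MM else 0.
Proof.
rewrite -commr_mpolyX; case: ifPn => [/submK {1}<-|nle].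
  by rewrite addmC mcoeffMX.
apply/eqP; rewrite mcoeff_eq0 (perm_mem (msuppMX _ _)); apply/mapP=> -[m' _ Dm].
by rewrite Dm lem_addr in nle.
Qed.

Lemma mcoeffXMD f u m : ('X_[u] * f)@_(u + m)%MM = f@_m.
Proof. by rewrite -commr_mpolyX mcoeffMX. Qed.

Lemma mcoeff_mulCX f c m u : (f * (c *: 'X_[m]))@_u = if (m <= u)%MM then f@_(u - m)%MM * c else 0.
Proof.
by rewrite mulrC -scalerAl mcoeffZ mcoeffXM; case: ifP; rewrite ?mulr0 // mulrC.
Qed.

End LeadingMonomials.

(** * Groebner bases and reduction *)

Section Groebner.

Variables (n : nat) (le : rel 'X_{1..n}) (le_mo : monomial_order le).
Variable C : comNzRingType.
Implicit Types (m : 'X_{1..n}) (f g : {mpoly C[n]}) (G : seq {mpoly C[n]}).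
Implicit Types (J : {mpoly C[n]} -> Prop).
Notation lt := (mlt le).
Notation LM := (LM le).
Notation LC := (LC le).
Notation LT := (LT le).

(** Certifies that a x^m lies in the ideal of the leading terms of G (see [ideal_LT_comb] and
    [comb_ideal_LT]). Several elements of G may be needed at once, unless the basis is strong. *)
Definition term_comb G m (a : C) (c : 'I_(size G) -> C) :=
  (forall i, c i != 0 -> (LM G`_i <= m)%MM) /\ a = \sum_i c i * LC G`_i.

(** The subtraction of exponents is truncated, but in a [term_comb] the coefficient [c i] vanishes
    whenever LM(G_i) does not divide m. *)
Definition lift_comb G m (c : 'I_(size G) -> C) :=
  \sum_(i < size G) c i *: ('X_[m - LM G`_i] * G`_i).

Lemma lift_comb_ideal J G m (c : 'I_(size G) -> C) :
  is_ideal J -> (forall g, g \in G -> J g) -> J (lift_comb m c).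
Proof.
move=> idJ JG; apply: ideal_sum => // i _.
by rewrite scalerAl; apply: idealM => //; apply/JG/mem_nth.
Qed.

Lemma lift_comb_le G m a (c : 'I_(size G) -> C) :
  term_comb m a c -> supp_le le m (lift_comb m c).
Proof.
case=> le_c _; apply: supp_le_sum => i _.
have [->|/le_c/submK Dm] := eqVneq (c i) 0; first by rewrite scale0r; apply: supp_le0.
rewrite -[X in supp_le _ X _]Dm.
by apply/supp_leZ/supp_leM => //; [apply: supp_leX | apply: supp_le_LM].
Qed.

Lemma lift_comb_coef G m a (c : 'I_(size G) -> C) :
  term_comb m a c -> (lift_comb m c)@_m = a.
Proof.
case=> le_c ->; rewrite raddf_sum; apply: eq_bigr => i _; rewrite /= mcoeffZ.
have [->|/le_c/submK Dm] := eqVneq (c i) 0; first by rewrite !mul0r.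
by rewrite -[X in _@_X]Dm mcoeffXMD.
Qed.

Lemma sub_lift_comb_lt G f (c : 'I_(size G) -> C) :
  term_comb (LM f) (LC f) c -> supp_lt le (LM f) (f - lift_comb (LM f) c).
Proof.
move=> Hc; apply: supp_le_lt.
  by apply: supp_leD; [apply: supp_le_LM | apply/supp_leN/lift_comb_le/Hc].
by rewrite mcoeffB (lift_comb_coef Hc) subrr.
Qed.

(** Comparing coefficients at x^m replaces the polynomial cofactors of the leading terms by
    constants. *)
Lemma ideal_LT_comb G a m :
  ideal_of [seq LT g | g <- G] (a *: 'X_[m]) -> exists c : 'I_(size G) -> C, term_comb m a c.
Proof.
case/ideal_ofP; rewrite size_map => h /(congr1 (mcoeff m)).
rewrite mcoeffZ mcoeffX eqxx mulr1 raddf_sum => ->.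
exists (fun i : 'I_(size G) => if (LM G`_i <= m)%MM then (h i)@_(m - LM G`_i)%MM else 0); split.
  by move=> i; case: ifP => //; rewrite eqxx.
apply: eq_bigr => i _; rewrite /= (nth_map 0) // /Defs.LT mcoeff_mulCX.
by case: ifP; rewrite ?mul0r.
Qed.

Lemma comb_ideal_LT G a m (c : 'I_(size G) -> C) :
  term_comb m a c -> ideal_of [seq LT g | g <- G] (a *: 'X_[m]).
Proof.
case=> le_c ->; rewrite scaler_suml; apply: ideal_sum => [|i _].
  exact: ideal_of_ideal.
have [->|/le_c/submK Dm] := eqVneq (c i) 0.
  by rewrite mul0r scale0r; apply: ideal0 (ideal_of_ideal _).
rewrite -Dm mpolyXD -scalerA scalerAr scalerAl; apply: (idealM (ideal_of_ideal _)).
by apply/ideal_of_mem/map_f/mem_nth.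
Qed.

Lemma groebner_comb J G f : groebner le J G -> J f -> f != 0 ->
  exists c : 'I_(size G) -> C, term_comb (LM f) (LC f) c.
Proof.
case=> _ GJ Jf f0; apply/ideal_LT_comb/GJ/ideal_gen_mem; by exists f.
Qed.

Lemma comb_groebner J G :
  (forall g, g \in G -> g != 0 /\ J g) ->
  (forall f, J f -> f != 0 ->
     exists c : 'I_(size G) -> C, term_comb (LM f) (LC f) c) ->
  groebner le J G.
Proof.
move=> JG GJ; split=> // h; split.
  apply: ideal_gen_min h => [|_ [f [Jf f0 ->]]]; first exact: ideal_of_ideal.
  by have [c /comb_ideal_LT] := GJ f Jf f0.
apply: ideal_gen_min h => [|_ /mapP[g /JG[g0 Jg] ->]]; first exact: ideal_gen_ideal.
by apply: ideal_gen_mem; exists g.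
Qed.

Lemma groebner_equiv J J' G : (forall f, J f <-> J' f) -> groebner le J G -> groebner le J' G.
Proof.
move=> eqJ gJ; apply: comb_groebner => [g /(proj1 gJ)[g0 /eqJ] //|f /eqJ Jf f0].
exact: groebner_comb gJ Jf f0.
Qed.

Lemma groebner_std J G f : is_ideal J -> groebner le J G -> J f ->
  exists H, std_rep le (G := G) f H.
Proof.
move=> idJ gJ; elim/(LM_ind le_mo): f => [_|f f0 IH Jf].
  exists 0; split=> [|i]; last by rewrite mxE eqxx.
  by rewrite big1 // => i _; rewrite mxE mul0r.
have [c Hc] := groebner_comb gJ Jf f0; have lt_f' := sub_lift_comb_lt Hc.
have [|H [Df' le_H]] := IH _ lt_f'.
  by apply: idealB => //; apply: lift_comb_ideal => // g /(proj1 gJ)[].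
exists (H + \row_i (c i *: 'X_[LM f - LM G`_i])); split=> [|i].
  rewrite -[LHS](subrK (lift_comb (LM f) c)) {1}Df' -big_split.
  by apply: eq_bigr => i _; rewrite /= !mxE mulrDl -scalerAl.
(* The leading monomial of the new quotient occurs in the recursive quotient or in the added term;
   each case satisfies the bound. *)
rewrite !mxE => Hi0; split=> //; have := LM_msupp le_mo Hi0.
move: (Defs.LM _ _) => u /msuppD_le; rewrite mem_cat => /orP[Hu|/[dup] cu].
  have /le_H[f'0 le_Hi] : H ord0 i != 0 by apply: contraTneq Hu => ->; rewrite msupp0.
  apply: mo_trans le_mo _ _ _ _ (mo_ltW (lt_f' _ (LM_msupp le_mo f'0))).
  by apply: mo_trans le_mo _ _ _ _ le_Hi; apply: mo_add (LM_max le_mo Hu).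
have ci0 : c i != 0 by apply: contraTneq cu => ->; rewrite scale0r msupp0.
move/msuppZ_le; rewrite msuppX inE => /eqP->.
by rewrite submK ?mo_refl // (proj1 Hc).
Qed.

Lemma groebner_gen J G f : is_ideal J -> groebner le J G -> J f <-> ideal_of G f.
Proof.
move=> idJ gJ; split=> [/(groebner_std idJ gJ)[H [-> _]]|].
  by apply/ideal_ofP; exists (fun i => H ord0 i).
by apply: ideal_of_min f => // g /(proj1 gJ)[].
Qed.

Lemma scaleX_inj (a b : C) (u v : 'X_{1..n}) :
  a != 0 -> a *: 'X_[u] = b *: 'X_[v] -> b = a /\ v = u.
Proof.
move=> a0 /(congr1 (mcoeff u)); rewrite !mcoeffZ !mcoeffX eqxx mulr1.
by case: eqP => [->|_]; rewrite ?mulr1 // mulr0 => Da; rewrite Da eqxx in a0.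
Qed.

Lemma strong_comb J G f : strong_groebner le J G -> J f -> f != 0 ->
  exists c u, exists2 g, g \in G &
    [/\ c != 0, LM f = (u + LM g)%MM & LC f = c * LC g].
Proof.
case=> _ GJ Jf f0; have [c [u [g gG]]] := GJ f f0 Jf.
rewrite /Defs.LT -scalerAr scalerA -mpolyXD => /scaleX_inj[|Dc Du]; first exact: LC_neq0.
exists c, u, g => //; split=> //; apply: contra_neq (LC_neq0 le_mo f0) => c0.
by rewrite -Dc c0 mul0r.
Qed.

Lemma strong_groebnerW J G : strong_groebner le J G -> groebner le J G.
Proof.
move=> sG; apply: comb_groebner => [g /(proj1 sG) //|f Jf f0].
have [c [u [g gG [_ DLM DLC]]]] := strong_comb sG Jf f0.
have lt_g : (index g G < size G)%N by rewrite index_mem.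
exists (fun i => if i == Ordinal lt_g then c else 0); split.
  move=> i; case: ifP => [/eqP-> _|_]; last by rewrite eqxx.
  by rewrite nth_index // DLM lem_addl.
rewrite (bigD1 (Ordinal lt_g)) //= eqxx nth_index // big1 ?addr0 // => i /negPf->.
by rewrite mul0r.
Qed.

End Groebner.

(** * Reduction steps over the integers *)

Section Reduction.

Variables (n : nat) (le : rel 'X_{1..n}) (le_mo : monomial_order le).
Implicit Types (f g : {mpoly int[n]}) (G F : seq {mpoly int[n]}).
Implicit Types (J : {mpoly int[n]} -> Prop).

Lemma red_step_ideal J F f h : is_ideal J -> (forall g, g \in F -> J g) ->
  red_step le F f h -> J h <-> J f.
Proof.
move=> idJ JF [_ [s [sP _ ->]]].
have Js : J (\sum_(c <- s) c.1.1 *: ('X_[c.1.2] * c.2)).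
  rewrite big_seq_cond; apply: ideal_sum => // c; rewrite andbT => /sP[cF _ _].
  by rewrite scalerAl; apply: idealM => //; apply: JF.
split=> [Jf|Jf]; last exact: idealB.
by rewrite -[f](subrK (\sum_(c <- s) c.1.1 *: ('X_[c.1.2] * c.2))); apply: idealD.
Qed.

Lemma red_star_ideal J F f h : is_ideal J -> (forall g, g \in F -> J g) ->
  red_star le F f h -> J h <-> J f.
Proof.
move=> idJ JF; elim=> // {}h r _ IH /(red_step_ideal idJ JF) Jr.
exact: iff_trans Jr IH.
Qed.

Lemma red_star_cons F f h r : red_step le F f h -> red_star le F h r -> red_star le F f r.
Proof.
move=> fh; elim=> [|h' r' _ IH h'r']; last exact: red_trans IH h'r'.
exact: red_trans (red_refl _ _ _) fh.
Qed.

Lemma red_step1 F f g c u : f != 0 -> g \in F -> c != 0 -> LM le f = (u + LM le g)%MM ->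
  LC le f = c * LC le g -> red_step le F f (f - c *: ('X_[u] * g)).
Proof.
move=> f0 gF c0 DLM DLC; split=> //; exists [:: (c, u, g)]; rewrite !big_seq1 /=.
split=> // [d|]; first by rewrite inE => /eqP->.
by rewrite /LT DLC DLM mpolyXD -scalerAr scalerA.
Qed.

(** Strongness makes LT(f) a multiple of a single LT(g), so a one-term reduction step is available
    at every nonzero element of J, and it lowers the leading monomial. *)
Lemma strong_red0 J G f : is_ideal J -> strong_groebner le J G -> J f -> red_star le G f 0.
Proof.
move=> idJ sG; elim/(LM_ind le_mo): f => [_|f f0 IH Jf]; first exact: red_refl.
have [c [u [g gG [c0 DLM DLC]]]] := strong_comb le_mo sG Jf f0.
have st := red_step1 f0 gG c0 DLM DLC; apply: red_star_cons (st) (IH _ _ _).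
  apply: supp_le_lt => //.
    apply: supp_leD; first exact: supp_le_LM.
    apply/supp_leN/supp_leZ; rewrite DLM.
    by apply: supp_leM => //; [apply: supp_leX | apply: supp_le_LM].
  by rewrite mcoeffB mcoeffZ {2}DLM mcoeffXMD -[_@_(LM le f)]/(LC le f) DLC subrr.
by apply/(red_step_ideal idJ _ st) => // h /(proj1 sG)[].
Qed.

End Reduction.

(** * The projection onto R[x] *)

Section Blocks.

Variables a b : nat.
Implicit Type m : 'X_{1..(a + b)%N}.

Definition mleft m : 'X_{1..a} := [multinom m (lshift b i) | i < a].

Lemma mcat_lshift (m1 : 'X_{1..a}) (m2 : 'X_{1..b}) i : mcat m1 m2 (lshift b i) = m1 i.
Proof. by rewrite mnmE (unsplitK (inl i)). Qed.

Lemma mcat_rshift (m1 : 'X_{1..a}) (m2 : 'X_{1..b}) i : mcat m1 m2 (rshift a i) = m2 i.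
Proof. by rewrite mnmE (unsplitK (inr i)). Qed.

Lemma mnm_splitP m m' : (forall i, m (lshift b i) = m' (lshift b i)) ->
  (forall i, m (rshift a i) = m' (rshift a i)) -> m = m'.
Proof.
by move=> eql eqr; apply/mnmP => i; case: (split_ordP i) => j ->.
Qed.

Lemma mleft_mcat (m1 : 'X_{1..a}) (m2 : 'X_{1..b}) : mleft (mcat m1 m2) = m1.
Proof. by apply/mnmP => i; rewrite mnmE mcat_lshift. Qed.

Lemma mright_mcat (m1 : 'X_{1..a}) (m2 : 'X_{1..b}) : mright (mcat m1 m2) = m2.
Proof. by apply/mnmP => i; rewrite mnmE mcat_rshift. Qed.

Lemma mcatK m : mcat (mleft m) (mright m) = m.
Proof. by apply: mnm_splitP => i; rewrite ?mcat_lshift ?mcat_rshift mnmE. Qed.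

Lemma mcat_eqE (m1 m1' : 'X_{1..a}) (m2 m2' : 'X_{1..b}) :
  (mcat m1 m2 == mcat m1' m2') = (m1 == m1') && (m2 == m2').
Proof.
apply/eqP/andP => [E|[/eqP-> /eqP->] //].
by rewrite -(mleft_mcat m1 m2) -{2}(mright_mcat m1 m2) E mleft_mcat mright_mcat.
Qed.

Lemma mcatD (m1 m1' : 'X_{1..a}) (m2 m2' : 'X_{1..b}) :
  (mcat m1 m2 + mcat m1' m2' = mcat (m1 + m1') (m2 + m2'))%MM.
Proof. by apply: mnm_splitP => i; rewrite mnmDE ?mcat_lshift ?mcat_rshift mnmDE. Qed.

Lemma lem_mcat (m1 m1' : 'X_{1..a}) (m2 m2' : 'X_{1..b}) :
  (mcat m1 m2 <= mcat m1' m2')%MM = (m1 <= m1')%MM && (m2 <= m2')%MM.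
Proof.
apply/mnm_lepP/andP => [le_m|[/mnm_lepP le1 /mnm_lepP le2] i].
  by split; apply/mnm_lepP => i; [have := le_m (lshift b i) | have := le_m (rshift a i)];
    rewrite ?mcat_lshift ?mcat_rshift.
by case: (split_ordP i) => j ->; rewrite ?mcat_lshift ?mcat_rshift.
Qed.

Variables (le : rel 'X_{1..(a + b)%N}) (le_mo : monomial_order le).

Lemma order_l_mo : monomial_order (order_l le).
Proof.
have inj u u' : mcat u 0%MM = mcat u' 0%MM :> 'X_{1..(a + b)%N} -> u = u'.
  by move/eqP; rewrite mcat_eqE => /andP[/eqP].
split.
- by move=> u; apply: mo_refl le_mo _.
- by move=> u u' /(mo_anti le_mo)/inj.
- by move=> u u' u''; apply: mo_trans le_mo _ _ _.
- by move=> u u'; apply: mo_total le_mo _ _.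
- by move=> u u' u'' /(mo_add le_mo (mcat u 0%MM)); rewrite !mcatD addm0.
- move=> u; move Dx: (mcat u 0%MM : 'X_{1..(a + b)%N}) => x.
  elim: (mo_wf le_mo x) u Dx => {}x _ IH u Dx; constructor=> u' /andP[ne le_m'].
  by apply: (IH (mcat u' 0%MM)) => //; rewrite -Dx /mlt [le _ _]le_m' andbT mcat_eqE eqxx andbT.
Qed.

Lemma order_r_mo : monomial_order (order_r le).
Proof.
have inj u u' : mcat 0%MM u = mcat 0%MM u' :> 'X_{1..(a + b)%N} -> u = u'.
  by move/eqP; rewrite mcat_eqE => /andP[_ /eqP].
split.
- by move=> u; apply: mo_refl le_mo _.
- by move=> u u' /(mo_anti le_mo)/inj.
- by move=> u u' u''; apply: mo_trans le_mo _ _ _.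
- by move=> u u'; apply: mo_total le_mo _ _.
- by move=> u u' u'' /(mo_add le_mo (mcat 0%MM u)); rewrite !mcatD addm0.
- move=> u; move Dx: (mcat 0%MM u : 'X_{1..(a + b)%N}) => x.
  elim: (mo_wf le_mo x) u Dx => {}x _ IH u Dx; constructor=> u' /andP[ne le_m'].
  by apply: (IH (mcat 0%MM u')) => //; rewrite -Dx /mlt [le _ _]le_m' andbT mcat_eqE eqxx.
Qed.

Hypothesis le_elim : elim_order le.

Lemma elim_le m m' : le m m' =
  mlt (order_l le) (mleft m) (mleft m')
  || (mleft m == mleft m') && order_r le (mright m) (mright m').
Proof.
rewrite mo_le_eqVlt // -{1 2}[m]mcatK -{1 2}[m']mcatK mcat_eqE le_elim.
rewrite [order_r _ _ _](mo_le_eqVlt order_r_mo).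
by case: eqP => //= ->; rewrite mo_ltn.
Qed.

(** Forgetting the smaller block is monotone; this bounds the x-monomials of an image in A. *)
Lemma elim_le_left m m' : le m m' -> order_l le (mleft m) (mleft m').
Proof.
rewrite elim_le => /orP[/mo_ltW //|/andP[/eqP-> _]].
exact: mo_refl order_l_mo _.
Qed.

End Blocks.

Definition ypow (k : nat) : 'X_{1..1} := (U_(ord0) *+ k)%MM.

Lemma ypowE k i : ypow k i = k.
Proof. by rewrite mulmnE mnm1E !ord1 eqxx mul1n. Qed.

Lemma ypow_eqE k l : (ypow k == ypow l) = (k == l).
Proof.
apply/eqP/eqP => [|-> //].
by move/(congr1 (fun m : 'X_{1..1} => m ord0)); rewrite !ypowE.
Qed.

(** In one variable divisibility is total, so it determines every monomial order. *)
Lemma order_ypow (le : rel 'X_{1..1}) k l : monomial_order le -> le (ypow k) (ypow l) = (k <= l)%N.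
Proof.
move=> le_mo; have lek i j : (i <= j)%N -> le (ypow i) (ypow j).
  by move=> le_ij; apply: mo_lem => //; apply/mnm_lepP => x; rewrite !ypowE.
have [/lek //|lt_lk] := leqP k l.
rewrite -[LHS]negbK -(mo_ltNge le_mo) /mlt ypow_eqE lek 1?ltnW // andbT.
by rewrite negbK; apply/negbTE; rewrite neq_ltn lt_lk.
Qed.

Lemma mnm_yP (r : nat) (m : 'X_{1..(r + 1)%N}) : m = mcat (mleft m) (ypow (m (rshift r ord0))).
Proof.
rewrite -[LHS]mcatK; congr mcat; apply/mnmP => i.
by rewrite ypowE mnmE (ord1 i).
Qed.

Section SumX.

Variables (n : nat) (C : nzRingType).

Lemma mcoeff_sumX (s : seq 'X_{1..n}) (P : pred 'X_{1..n}) (F : 'X_{1..n} -> C) a :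
  uniq s -> (\sum_(m <- s | P m) F m *: 'X_[m])@_a = if (a \in s) && P a then F a else 0.
Proof.
move=> us; rewrite raddf_sum /=.
under eq_bigr do rewrite mcoeffZ mcoeffX.
case: ifP => [/andP[a_s Pa]|a_s].
  rewrite big_mkcond (bigD1_seq a) //= Pa eqxx mulr1 big1 ?addr0 // => m /negPf->.
  by rewrite mulr0; case: ifP.
rewrite big_seq_cond big1 // => m /andP[m_s Pm].
by case: eqP => [Dm|_]; rewrite ?mulr0 //; rewrite -Dm m_s Pm in a_s.
Qed.

Lemma mcoeff_supp (f : {mpoly C[n]}) a : (if a \in msupp f then f@_a else 0) = f@_a.
Proof. by rewrite mcoeff_msupp; case: eqP. Qed.

End SumX.

HB.instance Definition _ (q r : nat) := GRing.RMorphism.copy (@psi q r)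
  (mmap (@mpolyC r {poly 'Z_q} \o intmul 1)
        (fun i => match split i with
                  | inl j => 'X_j
                  | inr _ => ('X : {poly 'Z_q})%:MP
                  end)).

HB.instance Definition _ (q r : nat) (fhat : {poly 'Z_q}) :=
  GRing.RMorphism.copy (@phi q r fhat) (map_mpoly (in_qpoly fhat)).

HB.instance Definition _ (q r : nat) (fhat : {poly 'Z_q}) :=
  GRing.RMorphism.copy (@phipsi q r fhat) (@phi q r fhat \o @psi q r).

Section Zq.

Variables (q : nat) (q_gt1 : (1 < q)%N).

Lemma intr_Zq_eq0 (c : int) : (c%:~R == 0 :> 'Z_q) = (q %| c)%Z.
Proof.
rewrite {1}(divz_eq c q) rmorphD rmorphM /= -[(q : int)%:~R]/(q%:R : 'Z_q).
rewrite pchar_Zp // mulr0 add0r (sameP dvdz_mod0P eqP).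
have : (0 <= (c %% q)%Z < q)%R by rewrite modz_ge0 ?ltz_pmod //; case: q q_gt1.
case: (c %% q)%Z => // k /= lt_kq.
by rewrite -[k%:~R]/(k%:R : 'Z_q) -val_eqE /= val_Zp_nat // modn_small.
Qed.

End Zq.

Section SurjectiveMorphism.

Variables (C D : comNzRingType) (f : {rmorphism C -> D}).
Hypothesis f_surj : forall y, exists x, f x = y.

Lemma ideal_of_image (s : seq C) x : ideal_of s x -> ideal_of [seq f c | c <- s] (f x).
Proof.
apply: (@ideal_of_min _ s (fun z => ideal_of [seq f c | c <- s] (f z))).
  exact: ideal_preim (ideal_of_ideal _).
by move=> {}x xs; apply/ideal_of_mem/map_f.
Qed.

Lemma ideal_of_lift (s : seq C) y :
  ideal_of [seq f c | c <- s] y -> exists2 x, ideal_of s x & f x = y.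
Proof.
apply: (@ideal_of_min _ _ (fun y => exists2 x, ideal_of s x & f x = y)).
  have idJ := ideal_of_ideal s; split.
  - by exists 0; rewrite ?rmorph0 //; apply: ideal0.
  - by move=> _ _ [x1 J1 <-] [x2 J2 <-]; exists (x1 + x2); rewrite ?rmorphD //; apply: idealD.
  - move=> c _ [x Jx <-]; have [c' <-] := f_surj c.
    by exists (c' * x); rewrite ?rmorphM //; apply: idealM.
by move=> _ /mapP[x xs ->]; exists x => //; apply: ideal_of_mem.
Qed.

Lemma ideal_of_preim (s : seq C) x : (forall z, f z = 0 -> ideal_of s z) ->
  ideal_of s x <-> ideal_of [seq f c | c <- s] (f x).
Proof.
move=> ker_f; split=> [|/ideal_of_lift[z Jz Dz]]; first exact: ideal_of_image.
rewrite -[x](subrK z); apply: (idealD (ideal_of_ideal s) _ Jz).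
by apply: ker_f; rewrite rmorphB Dz subrr.
Qed.

End SurjectiveMorphism.

(** * Coefficients, sections and kernel of the projection T -> A *)

Section Projection.

Variables (q r : nat) (fhat : {poly 'Z_q}).
Hypotheses (q_gt1 : (1 < q)%N) (fhat_monic : fhat \is monic).
Hypothesis fhat_gt1 : (1 < size fhat)%N.
Notation pi := (@phipsi q r fhat).
Implicit Types (g : Zyx r) (v : {mpoly {poly 'Z_q}[r]}) (w : {mpoly {poly %/ fhat}[r]}).

Lemma psiX m : psi q ('X_[m] : Zyx r) = 'X^(m (rshift r ord0)) *: 'X_[mleft m].
Proof.
rewrite /psi mmapX /mmap1 big_split_ord big_ord1 /= (unsplitK (inr ord0)) -rmorphXn mulrC.
rewrite -mul_mpolyC mpolyXE_id; congr (_ * _); apply: eq_bigr => i _.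
by rewrite (unsplitK (inl i)) mnmE.
Qed.

Lemma psiZ c g : psi q (c *: g) = c%:~R *: psi q g.
Proof. by rewrite /psi mmapZ /= mul_mpolyC. Qed.

Lemma psi_coef g a k : (psi q g)@_a`_k = (g@_(mcat a (ypow k)))%:~R.
Proof.
rewrite [in LHS](mpolyE g) (raddf_sum (@psi q r)) (raddf_sum (mcoeff a)) /= coef_sum.
rewrite -[in RHS](mcoeff_supp g).
have E m : (psi q (g@_m *: 'X_[m]))@_a`_k = if m == mcat a (ypow k) then (g@_m)%:~R else 0.
  rewrite psiZ mcoeffZ psiX mcoeffZ mcoeffX -(rmorph_int (@polyC 'Z_q)) mul_polyC coefZ.
  rewrite [X in if X == _ then _ else _](mnm_yP m) mcat_eqE ypow_eqE.
  case: (mleft m == a) => /=; last by rewrite mulr0 coef0 mulr0.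
  by rewrite mulr1 coefXn [k == _]eq_sym; case: (_ == k); rewrite ?mulr1 ?mulr0.
under eq_bigr do rewrite E.
rewrite -big_mkcond /=; case: ifP => [m_g|m_g].
  rewrite big_mkcond (bigD1_seq _ m_g) ?msupp_uniq //= eqxx big1 ?addr0 // => m.
  by move/negPf->.
rewrite big_seq_cond big1 // => m /andP[m_g' /eqP Dm].
by rewrite -Dm m_g' in m_g.
Qed.

Lemma psi_eq0 g : psi q g = 0 -> exists g', g = q%:R * g'.
Proof.
move=> g0; exists (\sum_(m <- msupp g) (g@_m %/ q)%Z *: 'X_[m]).
apply/mpolyP => m; rewrite mulr_natl mcoeffMn mcoeff_sumX ?msupp_uniq // andbT.
have /dvdzP[c Dc] : (q %| g@_m)%Z.
  by rewrite -intr_Zq_eq0 // (mnm_yP m) -psi_coef g0 mcoeff0 coef0.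
case: ifP => [_|/negbT/memN_msupp_eq0->]; last by rewrite mul0rn.
rewrite Dc mulzK; last by rewrite eqz_nat -lt0n ltnW.
by rewrite -mulr_natr natz.
Qed.

Lemma liftZ_coef v a k : (liftZ v)@_(mcat a (ypow k)) = (nat_of_ord (v@_a)`_k)%:Z.
Proof.
have E m i : ((nat_of_ord (v@_m)`_i)%:Z *: 'X_[mcat m (ypow i)] : Zyx r)@_(mcat a (ypow k))
    = if (m == a) && (i == k) then (nat_of_ord (v@_a)`_k)%:Z else 0.
  rewrite mcoeffZ mcoeffX mcat_eqE ypow_eqE.
  by case: eqP => [->|]; case: eqP => [->|]; rewrite /= ?mulr1 ?mulr0.
rewrite /liftZ raddf_sum /=.
under eq_bigr => m _.
  rewrite raddf_sum /=; under eq_bigr do rewrite E.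
over.
have [a_v|/memN_msupp_eq0 v_a0] := boolP (a \in msupp v); last first.
  by rewrite v_a0 coef0 big1 // => m _; rewrite big1 // => i _; case: ifP.
rewrite (bigD1_seq _ a_v) ?msupp_uniq //= [X in _ + X]big1 ?addr0; last first.
  by move=> m /negPf->; rewrite big1.
rewrite eqxx /=; have [lt_k|le_k] := ltnP k (size v@_a); last first.
  rewrite (nth_default 0 le_k) big1 // => i _.
  by rewrite if_same.
by rewrite (bigD1 (Ordinal lt_k)) //= eqxx big1 ?addr0 // => i; rewrite -val_eqE => /= /negPf->.
Qed.

Lemma psi_liftZ v : psi q (liftZ v) = v.
Proof.
apply/mpolyP => a; apply/polyP => k; rewrite psi_coef liftZ_coef.
by rewrite -[_%:~R]/(_%:R) natr_Zp.
Qed.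

(** [{poly %/ h}] is the quotient by [mk_monic h], which falls back to 'X unless h is monic of
    positive degree. *)
Lemma mk_monicE : mk_monic fhat = fhat.
Proof. by rewrite /mk_monic fhat_gt1 fhat_monic. Qed.

Lemma in_qpolyE h : in_qpoly fhat h = Pdiv.Ring.rmodp h fhat :> {poly 'Z_q}.
Proof. by rewrite /= mk_monicE. Qed.

Lemma in_qpoly_eq0 h : (in_qpoly fhat h == 0) = (Pdiv.Ring.rmodp h fhat == 0).
Proof. by rewrite -val_eqE /= mk_monicE. Qed.

Lemma in_qpolyK (x : {poly %/ fhat}) : in_qpoly fhat (x : {poly 'Z_q}) = x.
Proof. by apply: val_inj; rewrite /= Pdiv.Ring.rmodp_small // size_mk_monic. Qed.

Lemma size_qpoly (x : {poly %/ fhat}) : (size (x : {poly 'Z_q}) < size fhat)%N.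
Proof. by rewrite (leq_trans (size_mk_monic x)) ?mk_monicE. Qed.

Lemma dvd_rmodp h : (Pdiv.Ring.rmodp h fhat == 0) <-> exists k, h = k * fhat.
Proof.
split=> [/eqP h0|[k ->]]; last by rewrite Pdiv.RingMonic.rmodp_mull.
exists (Pdiv.Ring.rdivp h fhat).
by rewrite [LHS](Pdiv.RingMonic.rdivp_eq fhat_monic) h0 addr0.
Qed.

(** A section of [phi] that picks, in each coefficient, the remainder of degree less than that of
    [fhat]. *)
Definition unphi w : {mpoly {poly 'Z_q}[r]} :=
  \sum_(m <- msupp w) (w@_m : {poly 'Z_q}) *: 'X_[m].

Lemma unphi_coef w m : (unphi w)@_m = w@_m :> {poly 'Z_q}.
Proof.
rewrite mcoeff_sumX ?msupp_uniq // andbT; case: ifP => // /negbT/memN_msupp_eq0->.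
by [].
Qed.

Lemma phi_coef v m : (phi fhat v)@_m = in_qpoly fhat v@_m.
Proof. by rewrite /phi mcoeff_map_mpoly. Qed.

Lemma phi_unphi w : phi fhat (unphi w) = w.
Proof. by apply/mpolyP => m; rewrite phi_coef unphi_coef in_qpolyK. Qed.

Lemma phipsi_liftZ v : pi (liftZ v) = phi fhat v.
Proof. by rewrite /phipsi psi_liftZ. Qed.

Definition lift_bar w : Zyx r := liftZ (unphi w).

Lemma phipsi_lift_bar w : pi (lift_bar w) = w.
Proof. by rewrite phipsi_liftZ phi_unphi. Qed.

Lemma phipsi_surj w : exists g, pi g = w.
Proof. by exists (lift_bar w); apply: phipsi_lift_bar. Qed.

Lemma phi_eq0 v : phi fhat v = 0 -> exists k, v = k * fhat%:MP.
Proof.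
move=> v0; exists (\sum_(m <- msupp v) Pdiv.Ring.rdivp v@_m fhat *: 'X_[m]).
apply/mpolyP => m; rewrite mulrC mcoeffCM mcoeff_sumX ?msupp_uniq // andbT.
case: ifP => [_|/negbT/memN_msupp_eq0->]; last by rewrite mulr0.
have /eqP := congr1 (mcoeff m) v0; rewrite mcoeff0 phi_coef in_qpoly_eq0 => /eqP vm0.
by rewrite [LHS](Pdiv.RingMonic.rdivp_eq fhat_monic) vm0 addr0 mulrC.
Qed.

(** The cofactor k of [fhat] over Z/q lifts to T; after subtracting the lifted multiple of f, what
    remains vanishes under [psi] and is a multiple of q. *)
Lemma phipsi_eq0 g : pi g = 0 <-> ideal_of (moduli r fhat) g.
Proof.
have idM := ideal_of_ideal (moduli r fhat); split=> [|Mg].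
  move/phi_eq0=> [k Dk]; have [g' Dg] : exists g', g - liftZ k * liftZ (fhat%:MP) = q%:R * g'.
    by apply: psi_eq0; rewrite rmorphB rmorphM /= !psi_liftZ Dk subrr.
  rewrite -[g](subrK (liftZ k * liftZ (fhat%:MP))) Dg mulrC.
  by apply: (idealD idM); apply: (idealM idM); apply: ideal_of_mem; rewrite !inE eqxx ?orbT.
apply: (ideal_of_min (J := fun g => pi g = 0)) Mg.
  split=> [|x y x0 y0|c x x0]; first exact: rmorph0.
    by rewrite rmorphD /= x0 y0 addr0.
  by rewrite rmorphM /= x0 mulr0.
move=> x; rewrite !inE => /orP[] /eqP->.
  apply/mpolyP => m; rewrite phipsi_liftZ phi_coef mcoeffC mcoeff0.
  by apply/eqP; rewrite in_qpoly_eq0; apply/dvd_rmodp; exists (m == 0%MM)%:R; rewrite mulrC.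
rewrite rmorph_nat; apply/mpolyP => m; rewrite -mpolyC_nat mcoeffC mcoeff0.
rewrite -(rmorph_nat (in_qpoly fhat)).
by rewrite -(rmorph_nat (@polyC 'Z_q)) pchar_Zp // !rmorph0 mul0r.
Qed.

Lemma phipsi_moduli g : g \in moduli r fhat -> pi g = 0.
Proof. by move/ideal_of_mem/phipsi_eq0. Qed.

Lemma ideal_of_phipsi s g : {subset moduli r fhat <= s} ->
  ideal_of s g <-> ideal_of [seq pi x | x <- s] (pi g).
Proof.
move=> sub_s; apply: ideal_of_preim => [|x]; first exact: phipsi_surj.
by move/phipsi_eq0; apply: ideal_of_sub => y /sub_s/ideal_of_mem.
Qed.

Lemma phipsi_coef g a : (pi g)@_a = in_qpoly fhat (psi q g)@_a.
Proof. exact: phi_coef. Qed.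

End Projection.

(** * The Galois ring R *)

Section GaloisRing.

Variables (p n : nat) (p_pr : prime p) (n_gt0 : (0 < n)%N).
Let q := (p ^ n)%N.
Variable fhat : {poly 'Z_q}.
Hypotheses (fhat_monic : fhat \is monic) (fhat_gt1 : (1 < size fhat)%N).
Hypothesis fhat_irr : irreducible_poly (red_mod_p fhat).

Lemma prime_expn_gt1 : (1 < q)%N.
Proof. by rewrite -(expn0 p) ltn_exp2l // prime_gt1. Qed.

(** Residues modulo q reduce compatibly with the ring operations because p divides q. Having a
    morphism makes reduction modulo p multiplicative on polynomials. *)
Lemma Zq_to_Fp : exists rho : {rmorphism 'Z_q -> 'F_p},
  forall c, rho c = (nat_of_ord c)%:R.
Proof.
pose rho (c : 'Z_q) : 'F_p := (nat_of_ord c)%:R.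
have p0 : p%:R = 0 :> 'F_p by apply: pchar_Fp_0.
(* [(Zp_trunc q).+2] is the modulus built into 'Z_q; it equals q since q > 1, and multiples of q
   vanish in F_p. *)
have modq k : (k %% (Zp_trunc q).+2)%:R = k%:R :> 'F_p.
  rewrite [X in (k %% X)%N](Zp_cast prime_expn_gt1) [in RHS](divn_eq k q) natrD natrM natrX.
  rewrite p0 expr0n.
  by rewrite (gtn_eqF n_gt0) mulr0 add0r.
have rhoB : zmod_morphism rho.
  suff rhoD c d : rho (c + d) = rho c + rho d.
    by move=> c d; have := rhoD (c - d) d; rewrite subrK => ->; rewrite addrK.
  by rewrite /rho /= modq natrD.
have rhoM : monoid_morphism rho.
  split=> [|c d]; last by rewrite /rho /= modq natrM.
  by rewrite /rho /= modq.
pose rhoA := GRing.isZmodMorphism.Build _ _ rho rhoB.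
pose rhoR := GRing.isMonoidMorphism.Build _ _ rho rhoM.
pose rho' : {rmorphism 'Z_q -> 'F_p} := HB.pack rho rhoA rhoR.
by exists rho'.
Qed.

Lemma Zq_dvdp (c : 'Z_q) : (nat_of_ord c)%:R = 0 :> 'F_p -> exists d : 'Z_q, c = p%:R * d.
Proof.
move/eqP; rewrite -(dvdn_pcharf (pchar_Fp p_pr)) => /dvdnP[k Dc].
by exists k%:R; rewrite -natrM mulnC -Dc natr_Zp.
Qed.

Notation R := {poly %/ fhat}.

Lemma pX_eq0 : p%:R ^+ n = 0 :> R.
Proof.
rewrite -natrX -(rmorph_nat (in_qpoly fhat)) -(rmorph_nat (@polyC 'Z_q)).
by rewrite pchar_Zp ?prime_expn_gt1 // !rmorph0.
Qed.

(** Modulo p the irreducible [fhat] either divides the representative of x or is coprime to it. In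
    the first case the representative vanishes modulo p for degree reasons; in the second a lifted
    Bezout relation inverts x up to a multiple of p, which is nilpotent. *)
Lemma galois_local (x : R) : (exists y, x = p%:R * y) \/ (exists y, x * y = 1).
Proof.
have [rho rhoE] := Zq_to_Fp.
have redE h : red_mod_p h = map_poly rho h by apply: eq_map_poly => c; rewrite rhoE.
have ker_rho h : map_poly rho h = 0 -> exists h', h = p%:R * h'.
  move=> h0; have Dh i : exists d : 'Z_q, h`_i == p%:R * d.
    have [|d Dd] := @Zq_dvdp h`_i; last by exists d; apply/eqP.
    by rewrite -rhoE -[rho _]coef_map h0 coef0.
  exists (\poly_(i < size h) xchoose (Dh i)); apply/polyP => i.
  rewrite mulr_natl coefMn coef_poly; case: ltnP => [_|le_hi]; last by rewrite mul0rn nth_default.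
  by rewrite {1}(eqP (xchooseP (Dh i))) mulr_natl.
have rho_surj U : exists h, map_poly rho h = U.
  exists (\poly_(i < size U) (nat_of_ord U`_i)%:R); apply/polyP => i.
  rewrite coef_map /= coef_poly; case: ltnP => [_|le_Ui]; last by rewrite rmorph0 nth_default.
  by rewrite rmorph_nat natr_Zp.
have irr := fhat_irr; rewrite redE in irr; pose A : {poly 'Z_q} := x.
have Dx : x = in_qpoly fhat A by rewrite in_qpolyK.
have size_f : size (map_poly rho fhat) = size fhat.
  by rewrite size_map_poly_id0 // (monicP fhat_monic) rmorph1 oner_eq0.
have [f_A|/negP f_A] := boolP (map_poly rho fhat %| map_poly rho A).
  have [|B DA] := ker_rho A; last first.
    by left; exists (in_qpoly fhat B); rewrite Dx DA rmorphM rmorph_nat.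
  (* Being monic, [fhat] keeps its degree modulo p, while A has smaller degree; divisibility
     therefore forces the reduction of A to be 0. *)
  apply/eqP; apply: contraTT f_A => A0; apply/negP => /(dvdp_leq A0).
  rewrite size_f leqNgt => /negP[]; apply: leq_ltn_trans (size_qpoly _ _ x) => //.
  exact: size_poly.
right; have : coprimep (map_poly rho fhat) (map_poly rho A).
  by rewrite (irreducible_poly_coprime _ irr); apply/negP.
move/Bezout_eq1_coprimepP => [[u v] /= uv].
have [U DU] := rho_surj u; have [V DV] := rho_surj v.
have [|B DB] := ker_rho (U * fhat + V * A - 1).
  by rewrite rmorphB rmorphD !rmorphM /= DU DV uv rmorph1 subrr.
have f0 : in_qpoly fhat fhat = 0.
  by apply/eqP; rewrite in_qpoly_eq0 // Pdiv.RingMonic.rmodpp.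
have /(congr1 (in_qpoly fhat)) : V * A - 1 = p%:R * B - U * fhat.
  by rewrite -DB -[U * fhat + _ - 1]addrA [U * fhat + _]addrC addrK.
rewrite !rmorphB !rmorphM /= rmorph1 rmorph_nat f0 mulr0 subr0 -Dx.
set z := in_qpoly _ _; set b := in_qpoly _ _ => Dz.
(* Here z x = 1 + p b, and 1 + p b is inverted by a geometric series that stops at n terms because
   p^n = 0. *)
exists (z * \sum_(i < n) (- (p%:R * b)) ^+ i).
have := subrX1 (- (p%:R * b)) n; rewrite -mulrN exprMn pX_eq0 mul0r sub0r !mulrN -Dz.
move=> /(congr1 -%R); rewrite opprK -mulNr => E.
rewrite [RHS]E (_ : - (- (z * x - 1) - 1) = z * x) ?mulrA ?[x * z]mulrC //.
by rewrite opprB opprK addrC subrK.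
Qed.

(** Factors p are split off until the cofactor is a unit; this happens before the exponent n, since
    p^n = 0 and x is nonzero. *)
Lemma galois_p_power (x : {poly %/ fhat}) : x != 0 ->
  exists2 i, (i < n)%N & (exists y, x * y = p%:R ^+ i) /\ (exists y, x = y * p%:R ^+ i).
Proof.
move=> x0; suff: forall k, (k <= n)%N ->
    (exists2 i, (i < n)%N & (exists y, x * y = p%:R ^+ i) /\ (exists y, x = y * p%:R ^+ i))
    \/ (exists y, x = y * p%:R ^+ k).
  move=> /(_ n (leqnn n)) [//|[y Dx]].
  by move: x0; rewrite Dx pX_eq0 mulr0 eqxx.
elim=> [|k IH] lt_kn; first by right; exists x; rewrite mulr1.
have [|[y Dx]] := IH (ltnW lt_kn); first by left.
have [[z Dy]|[z yz]] := galois_local y.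
  by right; exists z; rewrite Dx Dy exprS mulrCA mulrA.
left; exists k => //; split; last by exists y.
by exists z; rewrite Dx mulrAC yz mul1r.
Qed.

End GaloisRing.

(** * The Groebner basis of the image ideal *)

Lemma lem_m0 k (m : 'X_{1..k}) : (m <= 0)%MM = (m == 0%MM).
Proof.
apply/idP/eqP => [/mnm_lepP m0|->]; last exact: lepm_refl.
by apply/mnmP => i; apply/eqP; have := m0 i; rewrite mnm0E leqn0.
Qed.

Section BarGroebner.

Variables (p n : nat) (p_pr : prime p) (n_gt0 : (0 < n)%N).
Let q := (p ^ n)%N.
Variable fhat : {poly 'Z_q}.
Hypotheses (fhat_monic : fhat \is monic) (fhat_gt1 : (1 < size fhat)%N).
Variables (r : nat) (le : rel 'X_{1..(r + 1)%N}).
Hypotheses (le_mo : monomial_order le) (le_elim : elim_order le).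
Notation R := {poly %/ fhat}.
Notation pi := (@phipsi q r fhat).
Notation le_x := (order_l le).
Implicit Types (g : Zyx r) (w : {mpoly {poly %/ fhat}[r]}).

Let q1 : (1 < q)%N := prime_expn_gt1 p_pr n_gt0.
Let x_mo : monomial_order le_x := order_l_mo le_mo.

Lemma phipsi_supp g a : a \in msupp (pi g) -> exists k, mcat a (ypow k) \in msupp g.
Proof.
rewrite mcoeff_msupp phipsi_coef => ga0.
have : (psi q g)@_a != 0 by apply: contraNneq ga0 => ->; rewrite rmorph0.
rewrite -lead_coef_eq0 lead_coefE psi_coef => gak; exists (size (psi q g)@_a).-1.
by rewrite mcoeff_msupp; apply: contraNneq gak => ->; rewrite rmorph0.
Qed.

(** Only an upper bound: the coefficient at [mleft (LM le g)] may vanish modulo [fhat] and q. *)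
Lemma phipsi_supp_le g : supp_le le_x (mleft (LM le g)) (pi g).
Proof.
move=> a /phipsi_supp[k /(LM_max le_mo)/(elim_le_left le_mo le_elim)].
by rewrite mleft_mcat.
Qed.

Lemma mcoeff_gt_LM g m : mlt le (LM le g) m -> g@_m = 0.
Proof.
move=> lt_m; apply: memN_msupp_eq0; apply: contraTN lt_m => /(LM_max le_mo).
by rewrite mo_ltNge // negbK.
Qed.

Lemma mlt_ypow a k l : mlt le (mcat a (ypow k)) (mcat a (ypow l)) = (k < l)%N.
Proof.
rewrite le_elim mo_ltn eqxx /= mo_ltNge; last exact: order_r_mo.
by rewrite (order_ypow _ _ (order_r_mo le_mo)) -ltnNge.
Qed.

Lemma size_psi_LM g a b : LM le g = mcat a (ypow b) -> (size (psi q g)@_a <= b.+1)%N.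
Proof.
move=> Dg; apply/leq_sizeP => k lt_bk; rewrite psi_coef mcoeff_gt_LM //.
by rewrite Dg mlt_ypow.
Qed.

(** With LM(g) free of y, the coefficient of x^a is a constant in (Z/q)[y], which reduction modulo
    [fhat] leaves unchanged. *)
Lemma phipsi_y0 g a : LM le g = mcat a 0%MM -> (pi g)@_a = (LC le g)%:~R.
Proof.
move=> Dg; have Dg' : LM le g = mcat a (ypow 0) by rewrite Dg /ypow mulm0n.
rewrite phipsi_coef [(psi q g)@_a]size1_polyC ?(size_psi_LM Dg') //.
by rewrite psi_coef -Dg' !rmorph_int.
Qed.

Lemma LM_phipsi_y0 g a : LM le g = mcat a 0%MM -> (LC le g)%:~R != 0 :> R ->
  [/\ pi g != 0, LM le_x (pi g) = a & LC le_x (pi g) = (LC le g)%:~R].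
Proof.
move=> Dg LCg; have g_a := phipsi_y0 Dg.
have DLM : LM le_x (pi g) = a.
  apply: LM_uniq => //; first by rewrite mcoeff_msupp g_a.
  by rewrite -(mleft_mcat a (0%MM : 'X_{1..1})) -Dg; apply: phipsi_supp_le.
split=> //; last by rewrite /LC DLM.
by apply: contraNneq LCg => pg0; rewrite -g_a pg0 mcoeff0.
Qed.

Lemma qpoly_natE k : ((k%:R : R) : {poly 'Z_q}) = (k%:R)%:P.
Proof.
rewrite -(rmorph_nat (in_qpoly fhat)) in_qpolyE // -(rmorph_nat (@polyC 'Z_q)).
by rewrite Pdiv.Ring.rmodp_small // (leq_ltn_trans (size_polyC_leq1 _)).
Qed.

Lemma lift_bar_coef w a k :
  (lift_bar w)@_(mcat a (ypow k)) = (nat_of_ord (w@_a : {poly 'Z_q})`_k)%:Z.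
Proof. by rewrite /lift_bar liftZ_coef unphi_coef. Qed.

(** As i < n, p^i is less than q and is its own integer representative; as a constant it is also its
    own remainder modulo [fhat]. So the lift has no power of y above x^a, and every other x-monomial
    of w is smaller than x^a. *)
Lemma LM_lift_bar w i : (i < n)%N -> w != 0 -> LC le_x w = p%:R ^+ i ->
  [/\ lift_bar w != 0, LM le (lift_bar w) = mcat (LM le_x w) 0%MM & LC le (lift_bar w) = (p ^ i)%N].
Proof.
move=> lt_in w0; rewrite -natrX => DLC; set a := LM le_x w.
have y0 : mcat a 0%MM = mcat a (ypow 0) by rewrite /ypow mulm0n.
have lt_pq : (p ^ i < q)%N by rewrite ltn_exp2l // prime_gt1.
have w_a : (lift_bar w)@_(mcat a (ypow 0)) = (p ^ i)%N.
  rewrite lift_bar_coef -[w@_a]/(LC le_x w) DLC qpoly_natE coefC eqxx.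
  by rewrite val_Zp_nat // modn_small.
have a_supp : mcat a (ypow 0) \in msupp (lift_bar w).
  by rewrite mcoeff_msupp w_a eqz_nat -lt0n expn_gt0 prime_gt0.
have DLM : LM le (lift_bar w) = mcat a (ypow 0).
  apply: LM_uniq => // m; rewrite (mnm_yP m) mcoeff_msupp lift_bar_coef.
  set b := mleft m; set k := m _ => wk0.
  have b_w : b \in msupp w.
    by rewrite mcoeff_msupp; apply: contraNneq wk0 => ->; rewrite coef0.
  have := LM_max x_mo b_w; rewrite mo_le_eqVlt // => /orP[/eqP Db|lt_ba].
    rewrite Db -[w@__]/(LC le_x w) DLC qpoly_natE coefC in wk0.
    rewrite Db; case: k wk0 => [_|k]; last by rewrite eqxx.
    exact: mo_refl.
  by apply: mo_ltW; rewrite le_elim lt_ba.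
rewrite y0 /LC DLM; split=> //.
by apply: contraTneq a_supp => ->; rewrite msupp0.
Qed.

Section Main.

Hypothesis fhat_irr : irreducible_poly (red_mod_p fhat).
Variables (J : Zyx r -> Prop) (Jb : {mpoly R[r]} -> Prop) (G : seq (Zyx r)).
Hypotheses (idJb : is_ideal Jb) (J_Jb : forall g, J g <-> Jb (pi g)).

(* Multiplying w by a suitable element of R turns its leading coefficient into
   a power p^i, and the canonical lift of the result has leading term p^i x^a,
   free of y. *)
Lemma bar_groebner : groebner le J G -> groebner le_x Jb (bar_set fhat G).
Proof.
move=> gJ; apply: comb_groebner => [v|w Jw w0].
  rewrite mem_filter => /andP[v0 /mapP[g /(proj1 gJ)[_ /J_Jb Jg] Dv]].
  by rewrite Dv in v0 *.
apply: (ideal_LT_comb (le := le_x)); set L := map _ _; set a := LM _ w.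
have idL : is_ideal (ideal_of L) := ideal_of_ideal L.
have LCw0 : LC le_x w != 0 by apply: LC_neq0.
have [i lt_in [[y Dy] [y' Dy']]] := galois_p_power p_pr n_gt0 fhat_monic fhat_gt1 fhat_irr LCw0.
(* LC(w) is a multiple of p^i, so it suffices to place p^i x^a in the ideal of leading terms. *)
rewrite Dy' -scalerA -mul_mpolyC; apply: (idealM idL).
pose w' := y *: w; have w'_a : w'@_a = p%:R ^+ i by rewrite mcoeffZ mulrC.
have pi0 : p%:R ^+ i != 0 :> R.
  by apply: contra_neq LCw0 => p0; rewrite Dy' p0 mulr0.
have DLM : LM le_x w' = a.
  apply: LM_uniq => //; first by rewrite mcoeff_msupp w'_a.
  by apply/supp_leZ/supp_le_LM.
have w'0 : w' != 0 by apply: contra_neq pi0 => w'0; rewrite -w'_a w'0 mcoeff0.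
have [|h0 hLM hLC] := LM_lift_bar lt_in w'0; first by rewrite /LC DLM.
have Jh : J (lift_bar w').
  by apply/J_Jb; rewrite phipsi_lift_bar // /w' -mul_mpolyC; apply: idealM.
have [c [le_c Dp]] := groebner_comb gJ Jh h0.
rewrite hLM DLM in le_c; rewrite -natrX -[_%:R]/((p ^ i)%N%:~R) -hLC Dp rmorph_sum /= scaler_suml.
apply: ideal_sum => // j _; rewrite rmorphM /=.
have [->|/le_c] := eqVneq (c j) 0; first by rewrite mul0r scale0r; apply: ideal0.
set g := G`_j; rewrite -[X in (X <= _)%MM]mcatK lem_mcat => /andP[le_a].
rewrite lem_m0 => /eqP g_y.
have DLMg : LM le g = mcat (mleft (LM le g)) 0%MM by rewrite -g_y mcatK.
(* A summand whose leading coefficient dies in R contributes nothing, whether or not its image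
   appears in [bar_set]. *)
have [->|LCg] := eqVneq ((LC le g)%:~R : R) 0.
  by rewrite mulr0 scale0r; apply: ideal0.
have [pg0 pgLM pgLC] := LM_phipsi_y0 DLMg LCg.
have Lg : ideal_of L (LT le_x (pi g)).
  by apply/ideal_of_mem/map_f; rewrite mem_filter pg0 map_f // mem_nth.
rewrite -(submK le_a) mpolyXD -scalerA scalerAr scalerAl -pgLC -[X in _ * (_ *: 'X_[X])]pgLM.
exact: idealM.
Qed.

End Main.

Lemma LM_fhat (f := liftZ (fhat%:MP : {mpoly {poly 'Z_q}[r]})) :
  [/\ f != 0, LM le f = mcat 0%MM (ypow (size fhat).-1) & LC le f = 1].
Proof.
have f_coef a k : f@_(mcat a (ypow k)) = if a == 0%MM then (nat_of_ord fhat`_k)%:Z else 0.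
  by rewrite liftZ_coef mcoeffC; case: (a == 0%MM); rewrite ?mulr1 ?mulr0 ?coef0.
have f_m : f@_(mcat 0%MM (ypow (size fhat).-1)) = 1.
  by rewrite f_coef eqxx -lead_coefE (monicP fhat_monic).
have supp_m : mcat 0%MM (ypow (size fhat).-1) \in msupp f by rewrite mcoeff_msupp f_m.
have DLM : LM le f = mcat 0%MM (ypow (size fhat).-1).
  apply: LM_uniq => // m; rewrite (mnm_yP m) mcoeff_msupp f_coef.
  case: ifP => [/eqP->|_]; last by rewrite eqxx.
  set k := m _ => fk; rewrite mo_leNgt // mlt_ypow -leqNgt.
  rewrite -ltnS prednK ?(ltnW fhat_gt1) //; rewrite ltnNge; apply: contra fk => le_k.
  by rewrite nth_default.
by split=> //; [apply: contraTneq supp_m => ->; rewrite msupp0 | rewrite /LC DLM].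
Qed.

Lemma LM_q : [/\ (q%:R : Zyx r) != 0, LM le (q%:R : Zyx r) = 0%MM & LC le (q%:R : Zyx r) = q%:Z].
Proof.
have q0 : (q%:Z != 0) by rewrite eqz_nat -lt0n ltnW.
have qE : (q%:R : Zyx r) = (q%:Z)%:MP by rewrite -mpolyC_nat natz.
have DLM : LM le (q%:R : Zyx r) = 0%MM.
  by rewrite qE /LM msuppC (negPf q0) /= mo_refl.
by rewrite /LC DLM qE mcoeffC eqxx mulr1 mpolyC_eq0.
Qed.

(* Either q divides LC g, or the y-degree of LM g is at least the degree of the
   monic polynomial fhat. *)
Lemma ker_reducible F g : {subset moduli r fhat <= F} -> g != 0 -> pi g = 0 ->
  exists h, red_step le F g h.
Proof.
move=> sub_F g0 pg0; have LCg := LC_neq0 le_mo g0.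
have [qF fF] : q%:R \in F /\ liftZ (fhat%:MP : {mpoly {poly 'Z_q}[r]}) \in F.
  by split; apply: sub_F; rewrite !inE eqxx ?orbT.
have [q0 qLM qLC] := LM_q; have [f0 fLM fLC] := LM_fhat.
set a := mleft (LM le g); set b := LM le g (rshift r ord0).
have Dg : LM le g = mcat a (ypow b) := mnm_yP (LM le g).
have [/dvdzP[c Dc]|q'c] := boolP (q %| LC le g)%Z.
  exists (g - c *: ('X_[LM le g] * q%:R)); apply: red_step1 => //.
  - by apply: contra_neq LCg => c0; rewrite Dc c0 mul0r.
  - by rewrite qLM addm0.
  - by rewrite Dc qLC.
have [K DK] := phi_eq0 fhat_monic fhat_gt1 pg0.
have gab : (psi q g)@_a`_b != 0 by rewrite psi_coef -Dg intr_Zq_eq0.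
have DKa : (psi q g)@_a = K@_a * fhat by rewrite DK mulrC mcoeffCM mulrC.
(* Over x^a, the coefficient of [psi q g] has degree at most b in y and is nonzero because q does
   not divide LC(g); a nonzero multiple of the monic [fhat] has at least the degree of [fhat]. *)
have le_fb : ((size fhat).-1 <= b)%N.
  rewrite -ltnS prednK ?(ltnW fhat_gt1) //; apply: leq_trans (size_psi_LM Dg).
  rewrite DKa size_Mmonic //; last first.
    by apply: contra_neq gab => K0; rewrite DKa K0 mul0r coef0.
  have : K@_a != 0 by apply: contra_neq gab => K0; rewrite DKa K0 mul0r coef0.
  by rewrite -size_poly_gt0; case: (size K@_a) => // k _; rewrite addSn leq_addl.
pose u : 'X_{1..(r + 1)%N} := mcat a (ypow (b - (size fhat).-1)).
exists (g - LC le g *: ('X_[u] * liftZ fhat%:MP)); apply: red_step1 => //.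
  rewrite fLM mcatD addm0 Dg; congr mcat; apply/mnmP => j.
  by rewrite mnmDE !ypowE subnK.
by rewrite fLC mulr1.
Qed.

Lemma spoly_run_ker S G P : {subset moduli r fhat <= S} ->
  (forall g, g \in S -> g \notin moduli r fhat -> pi g != 0) ->
  spoly_run le S G P ->
  {subset moduli r fhat <= G} /\ (forall g, g \in G -> g \notin moduli r fhat -> pi g != 0).
Proof.
move=> MS S0; elim=> // {}G {}P f g h _ [MG G0] fG gG _ _ _ _ hG.
case: eqVneq => [//|h0]; split=> [x /MG xG|x]; first by rewrite mem_rcons inE xG orbT.
rewrite mem_rcons inE => /orP[/eqP->|]; last exact: G0.
move=> _; case: hG => [h0'|[_ min_h]]; first by rewrite h0' eqxx in h0.
by apply/eqP => /(ker_reducible MG h0)[h' /min_h].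
Qed.

End BarGroebner.

(** * Splitting modulo fhat and coset representatives *)

Section Splitting.

Variables (q r : nat) (fhat : {poly 'Z_q}).
Hypotheses (q_gt1 : (1 < q)%N) (fhat_monic : fhat \is monic).
Hypothesis fhat_gt1 : (1 < size fhat)%N.
Implicit Types (v : {mpoly {poly 'Z_q}[r]}).

Lemma split_out_coef v a :
  (split_out fhat v)@_a = if Pdiv.Ring.rmodp v@_a fhat != 0 then v@_a else 0.
Proof.
rewrite mcoeff_sumX ?msupp_uniq //; case: ifP => [/andP[_ ->] //|].
by rewrite mcoeff_msupp; case: eqP => [->|_ /= ->] //; rewrite if_same.
Qed.

Lemma split_in_coef v a :
  (split_in fhat v)@_a = if Pdiv.Ring.rmodp v@_a fhat == 0 then v@_a else 0.
Proof.
rewrite mcoeff_sumX ?msupp_uniq //; case: ifP => [/andP[_ ->] //|].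
by rewrite mcoeff_msupp; case: eqP => [->|_ /= ->] //; rewrite if_same.
Qed.

Lemma split_sum v : v = split_out fhat v + split_in fhat v.
Proof.
apply/mpolyP => a; rewrite mcoeffD split_out_coef split_in_coef.
by case: eqP => _; rewrite ?addr0 ?add0r.
Qed.

Lemma split_outN v a : a \in msupp (split_out fhat v) ->
  Pdiv.Ring.rmodp (split_out fhat v)@_a fhat != 0.
Proof.
by rewrite mcoeff_msupp split_out_coef; case: ifP => //; rewrite eqxx.
Qed.

Lemma split_out_ideal v a : a \in msupp (split_out fhat v) ->
  ~ ideal_of [:: fhat] (split_out fhat v)@_a.
Proof.
by move=> /split_outN/negP va0 /ideal_of1P Ha; apply/va0/dvd_rmodp.
Qed.

Lemma split_in_ideal v a : ideal_of [:: fhat] (split_in fhat v)@_a.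
Proof.
apply/ideal_of1P/dvd_rmodp => //; rewrite split_in_coef.
by case: ifP => [//|_]; rewrite Pdiv.Ring.rmod0p.
Qed.

Lemma phi_split_out v : phi fhat v = phi fhat (split_out fhat v).
Proof.
apply/mpolyP => a; rewrite [LHS]phi_coef [RHS]phi_coef split_out_coef; case: eqP => [/eqP va0|//].
by rewrite rmorph0; apply/eqP; rewrite in_qpoly_eq0.
Qed.

Lemma phiE v : phi fhat v = \sum_(a <- msupp v) in_qpoly fhat v@_a *: 'X_[a].
Proof.
apply/mpolyP => a; rewrite phi_coef (mcoeff_sumX xpredT) ?msupp_uniq // andbT.
by case: ifP => // /negbT/memN_msupp_eq0->; rewrite rmorph0.
Qed.

End Splitting.

(** * Totally reduced polynomials as coset representatives *)

Section TotalReduction.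

Variables (n : nat) (le : rel 'X_{1..n}) (le_mo : monomial_order le).
Variables (J : {mpoly int[n]} -> Prop) (G : seq {mpoly int[n]}).
Hypotheses (idJ : is_ideal J) (gJ : groebner le J G).
Variable rep : seq int -> int -> int.
Hypothesis rep_eff : effective_reps rep.
Implicit Types (f g : {mpoly int[n]}) (m : 'X_{1..n}).

(** Links the list ideal to which [rep] is applied with the coefficient vectors indexed by G. *)
Lemma term_combP m a :
  ideal_of (lc_gens le G m) a <-> exists c : 'I_(size G) -> int, term_comb le m a c.
Proof.
split=> [|[c [le_c ->]]]; last first.
  have idL := ideal_of_ideal (lc_gens le G m); apply: ideal_sum => // i _.
  have [->|/le_c le_m] := eqVneq (c i) 0; first by rewrite mul0r; apply: ideal0.
  apply: (idealM idL); apply/ideal_of_mem/map_f.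
  by rewrite mem_filter le_m mem_nth.
apply: (ideal_of_min (J := fun a => exists c : 'I_(size G) -> int, term_comb le m a c)).
  split.
  - exists (fun _ => 0); split=> [i|]; first by rewrite eqxx.
    by rewrite big1 // => i _; rewrite mul0r.
  - move=> a1 a2 [c1 [le1 ->]] [c2 [le2 ->]]; exists (fun i => c1 i + c2 i); split.
      move=> i; have [->|/le1 //] := eqVneq (c1 i) 0.
      by rewrite add0r => /le2.
    by rewrite -big_split; apply: eq_bigr => i _; rewrite mulrDl.
  - move=> b a1 [c1 [le1 ->]]; exists (fun i => b * c1 i); split.
      move=> i; have [->|/le1 //] := eqVneq (c1 i) 0.
      by rewrite mulr0 eqxx.
    by rewrite mulr_sumr; apply: eq_bigr => i _; rewrite mulrA.
move=> a1 /mapP[g + ->]; rewrite mem_filter => /andP[le_g gG].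
have lt_g : (index g G < size G)%N by rewrite index_mem.
exists (fun i => (i == Ordinal lt_g)%:R); split.
  by move=> i; case: (i =P _) => [-> _|_ /negP[]//]; rewrite nth_index.
rewrite (bigD1 (Ordinal lt_g)) //= eqxx nth_index // mul1r big1 ?addr0 // => i /negPf->.
by rewrite mul0r.
Qed.

(** Effective representatives need not send 0 to 0, so the zero coset is recognised by comparison
    with [rep s 0]. *)
Lemma rep_ideal s a : ideal_of s a <-> rep s a = rep s 0.
Proof.
have [rep1 rep2] := rep_eff s; have idJs := ideal_of_ideal s.
split=> [Ja|E]; first by apply: rep2; rewrite subr0.
rewrite -[a](subrK (rep s a)); apply: (idealD idJs) => //.
by rewrite E -[rep s 0]opprK -[- rep s 0]sub0r; apply: idealN.
Qed.

(** The bound on the support keeps the recursively obtained remainder below m, so that adding b x^m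
    leaves its coefficients intact. *)
Lemma totally_reduced_exists f :
  exists c, [/\ totally_reduced le rep G c, J (f - c) &
    forall m, supp_lt le m f -> supp_lt le m c].
Proof.
move: f; apply: (LM_ind le_mo) => [|f f0 IH].
  exists 0; split=> //; first by move=> m; rewrite msupp0.
  by rewrite subr0; apply: ideal0.
set m := LM le f; set a := LC le f; set L := lc_gens le G m.
have idL := ideal_of_ideal L; have [rep1 rep2] := rep_eff L.
(* In a totally reduced polynomial a coefficient in the zero coset must be absent, whatever [rep]
   chooses for that coset. *)
pose b := if rep L a == rep L 0 then 0 else rep L a.
have Lab : ideal_of L (a - b).
  rewrite /b; case: eqP => [/rep_ideal|_]; first by rewrite subr0.
  exact: rep1.
have [c Hc] := (term_combP m (a - b)).1 Lab.
pose f' := f - b *: 'X_[m] - lift_comb le m c.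
have lt_f' : supp_lt le m f'.
  apply: supp_le_lt; rewrite /f'.
    apply: supp_leD; last by apply/supp_leN/(lift_comb_le le_mo Hc).
    apply: supp_leD; first exact: supp_le_LM.
    exact/supp_leN/supp_leZ/supp_leX.
  rewrite !mcoeffB (lift_comb_coef Hc) mcoeffZ mcoeffX eqxx mulr1.
  by rewrite -[f@_m]/a subrr.
have [c' [red_c' Jc' lt_c']] := IH _ lt_f'; exists (c' + b *: 'X_[m]).
have c'm u : u \in msupp c' -> (u == m) = false.
  by move=> /(lt_c' _ lt_f')/andP[/negPf].
split.
- move=> u; have [->|ne_um] := eqVneq u m.
    rewrite mcoeff_msupp mcoeffD mcoeffZ mcoeffX eqxx mulr1.
    have -> : c'@_m = 0.
      by apply/memN_msupp_eq0/negP => /c'm; rewrite eqxx.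
    rewrite add0r -/L => b0; have Db : b = rep L a.
      by move: b0; rewrite /b; case: ifP => //; rewrite eqxx.
    split; last by rewrite Db; apply/esym/rep2; rewrite -Db.
    move=> Lb; case/eqP: b0; rewrite /b; case: eqP => // ne.
    by case: ne; apply/rep_ideal; rewrite -(subrK b a); apply: idealD.
  rewrite mcoeff_msupp mcoeffD mcoeffZ mcoeffX [m == u]eq_sym (negPf ne_um) mulr0 addr0.
  by rewrite -mcoeff_msupp => /red_c'.
- have -> : f - (c' + b *: 'X_[m]) = f' - c' + lift_comb le m c.
    by rewrite addrAC subrK opprD addrA addrAC.
  by apply: idealD => //; apply: lift_comb_ideal => // g /(proj1 gJ)[].
- move=> u lt_f; have lt_mu : mlt le m u by apply/lt_f/LM_msupp.
  apply: supp_ltD; last exact/supp_ltZ/(supp_le_lt_trans le_mo lt_mu)/supp_leX.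
  exact/(supp_le_lt_trans le_mo lt_mu)/supp_ltW/lt_c'.
Qed.

(** The leading coefficient of c - c' lies in the ideal of leading coefficients at its monomial m.
    If m occurs in both polynomials, congruent chosen representatives are equal; if it occurs in
    only one, the coefficient there lies in the excluded ideal. *)
Lemma totally_reduced_uniq c c' : totally_reduced le rep G c ->
  totally_reduced le rep G c' -> J (c - c') -> c = c'.
Proof.
move=> red_c red_c' Jcc'; apply/eqP; rewrite -subr_eq0; apply: contraT => cc'0.
have /term_combP := groebner_comb gJ Jcc' cc'0.
have := LM_msupp le_mo cc'0; rewrite mcoeff_msupp /LC.
set m := LM le _; set L := lc_gens le G m; rewrite mcoeffB => ne_cc' Lcc'.
have idL := ideal_of_ideal L.
have [c_m|/memN_msupp_eq0 c_m] := boolP (m \in msupp c); last first.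
  rewrite c_m sub0r oppr_eq0 -mcoeff_msupp in ne_cc' Lcc'.
  have [] := red_c' _ ne_cc'; case; rewrite -[_@__]opprK; exact: idealN.
have [c'_m|/memN_msupp_eq0 c'_m] := boolP (m \in msupp c'); last first.
  by rewrite c'_m subr0 in Lcc'; have [[]] := red_c _ c_m.
have [_ rc] := red_c _ c_m; have [_ rc'] := red_c' _ c'_m.
by case/eqP: ne_cc'; rewrite -rc -rc' (proj2 (rep_eff L) _ _ Lcc') subrr.
Qed.

Lemma totally_reduced_reps : complete_reps J (totally_reduced le rep G).
Proof.
move=> f; have [c [red_c Jc _]] := totally_reduced_exists f; exists c; split=> //.
move=> c' [red_c' Jc']; apply: totally_reduced_uniq => //.
have -> : c - c' = (f - c') - (f - c) by rewrite opprB [RHS]addrC addrA subrK.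
exact: idealB.
Qed.

End TotalReduction.

(** * Elimination, intersections, quotients and kernels *)

(** Since f(a) f(b) - g(a) g(b) = f(a) (f(b) - g(b)) + g(b) (f(a) - g(a)), the congruence spreads
    from the variables to all polynomials. The zero ideal gives [mmorph_ext]; the graph ideal allows
    each z_i to be replaced by u_i. *)
Lemma mmorph_congr (n : nat) (C D : comNzRingType) (f g : {rmorphism {mpoly C[n]} -> D})
    (J : D -> Prop) : is_ideal J -> (forall c, f c%:MP = g c%:MP) ->
  (forall i, J (f 'X_i - g 'X_i)) -> forall w, J (f w - g w).
Proof.
move=> idJ fgC fgX.
have JM a b : J (f a - g a) -> J (f b - g b) -> J (f (a * b) - g (a * b)).
  move=> Ja Jb; rewrite !rmorphM /=.
  have -> : f a * f b - g a * g b = f a * (f b - g b) + g b * (f a - g a).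
    by rewrite !mulrBr [g b * f a]mulrC [g b * g a]mulrC addrA subrK.
  by apply: idealD => //; apply: idealM.
have J1 a : f a = g a -> J (f a - g a) by move=> ->; rewrite subrr; apply: ideal0.
move=> w; rewrite (mpolyE w) (raddf_sum f) (raddf_sum g) -sumrB; apply: ideal_sum => // m _ /=.
rewrite -mul_mpolyC; apply: (JM); first exact/J1/fgC.
rewrite mpolyXE_id; elim/big_ind: _ => [|a b|i _]; first by apply: J1; rewrite !rmorph1.
  exact: JM.
elim: (m i) => [|k IH]; first by apply: J1; rewrite !expr0 !rmorph1.
by rewrite exprS; apply: JM.
Qed.

Lemma mmorph_ext (n : nat) (C D : comNzRingType) (f g : {rmorphism {mpoly C[n]} -> D}) :
  (forall c, f c%:MP = g c%:MP) -> (forall i, f 'X_i = g 'X_i) -> forall w, f w = g w.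
Proof.
move=> fgC fgX w; apply/eqP; rewrite -subr_eq0; apply/eqP.
apply: (mmorph_congr (J := fun x => x = 0)) => // [|i]; last by rewrite fgX subrr.
by split=> // [a b -> ->|c a ->]; rewrite ?addr0 ?mulr0.
Qed.

HB.instance Definition _ (n n' : nat) (C : comNzRingType) (s : 'I_n -> 'I_n') :=
  GRing.RMorphism.copy (@mrename n n' C s) (comp_mpoly [tuple 'X_(s i) | i < n]).

HB.instance Definition _ (r r' : nat) (s : 'I_r -> 'I_r') :=
  GRing.RMorphism.copy (@embedT r r' s) (mrename (fun i => match split i with
                    | inl j => lshift 1 (s j)
                    | inr j => rshift r' j
                    end)).

Lemma comp_mpolyXi (n k : nat) (C : comNzRingType) (lq : n.-tuple {mpoly C[k]}) i :
  'X_i \mPo lq = tnth lq i.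
Proof. by rewrite comp_mpolyXU -tnth_nth. Qed.

Section Renaming.

Variables (n n' : nat) (C : comNzRingType) (s : 'I_n -> 'I_n').

Lemma mrenameC (c : C) : mrename s c%:MP = c%:MP.
Proof. exact: comp_mpolyC. Qed.

Lemma mrenameX i : mrename s ('X_i : {mpoly C[n]}) = 'X_(s i).
Proof. by rewrite /mrename comp_mpolyXU -tnth_nth tnth_mktuple. Qed.

Lemma comp_mrename k (lq : n'.-tuple {mpoly C[k]}) (w : {mpoly C[n]}) :
  mrename s w \mPo lq = w \mPo [tuple tnth lq (s i) | i < n].
Proof.
apply: (mmorph_ext (f := comp_mpoly lq \o mrename s) (g := comp_mpoly _)) => [c|i] /=.
  by rewrite mrenameC !comp_mpolyC.
by rewrite mrenameX !comp_mpolyXi tnth_mktuple.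
Qed.

End Renaming.

Section Elimination.

Variables (C : comNzRingType) (a b : nat) (le : rel 'X_{1..(a + b)%N}).
Hypotheses (le_mo : monomial_order le) (le_elim : elim_order le).
Notation iota := (@mrename _ _ C (@rshift a b)).
Notation le_r := (order_r le).
Implicit Types (w : {mpoly C[b]}) (v : {mpoly C[(a + b)%N]}).

Let r_mo : monomial_order le_r := order_r_mo le_mo.

Lemma iotaE w : iota w = \sum_(m <- msupp w) w@_m *: 'X_[mcat 0%MM m].
Proof.
rewrite /mrename comp_mpolyEX; apply: eq_bigr => m _; congr (_ *: _).
rewrite comp_mpolyX mpolyXE_id big_split_ord /= [X in _ = X * _]big1 => [|i _]; last first.
  by rewrite mcat_lshift mnm0E expr0.
by rewrite mul1r; apply: eq_bigr => i _; rewrite mcat_rshift tnth_mktuple.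
Qed.

Lemma iota_coef w m : (iota w)@_m = if mleft m == 0%MM then w@_(mright m) else 0.
Proof.
have E u : (mcat 0%MM u == m) = (mleft m == 0%MM) && (u == mright m).
  by rewrite -{1}(mcatK m) mcat_eqE [0%MM == _]eq_sym.
rewrite iotaE raddf_sum /= -[w@_(mright m)]mcoeff_supp.
under eq_bigr do rewrite mcoeffZ mcoeffX E.
case: ifP => [_|_]; last by rewrite big1 // => u _; rewrite mulr0.
case: ifP => [mw|mw]; last first.
  rewrite big_seq_cond big1 // => u /andP[uw _] /=.
  by case: eqP => [Du|_]; rewrite ?mulr0 // -Du uw in mw *.
rewrite (bigD1_seq _ mw) ?msupp_uniq //= eqxx mulr1 big1 ?addr0 // => u.
by move=> /negPf->; rewrite mulr0.
Qed.

Lemma iota_inj : injective iota.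
Proof.
move=> w1 w2 E; apply/mpolyP => m; have := congr1 (mcoeff (mcat 0%MM m)) E.
by rewrite !iota_coef mleft_mcat mright_mcat eqxx.
Qed.

Lemma LM_iota w : w != 0 -> LM le (iota w) = mcat 0%MM (LM le_r w) /\ LC le (iota w) = LC le_r w.
Proof.
move=> w0; have LMw := LM_msupp r_mo w0.
have w_c : (iota w)@_(mcat 0%MM (LM le_r w)) = LC le_r w.
  by rewrite iota_coef mleft_mcat mright_mcat eqxx.
suff DLM : LM le (iota w) = mcat 0%MM (LM le_r w) by rewrite /LC DLM w_c.
apply: LM_uniq => //; first by rewrite mcoeff_msupp w_c -mcoeff_msupp.
move=> m; rewrite mcoeff_msupp iota_coef; case: ifP => [/eqP m0|_]; last by rewrite eqxx.
by rewrite -mcoeff_msupp => /(LM_max r_mo) le_m; rewrite -(mcatK m) m0.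
Qed.

(** Together with [free_left], the two ingredients of [elim_part]; it inverts [iota] on the
    polynomials free of the first block. *)
Definition uncat v : {mpoly C[b]} := \sum_(m <- msupp v) v@_m *: 'X_[mright m].

Definition free_left v := all (fun m : 'X_{1..(a + b)%N} =>
  [forall i : 'I_a, m (lshift b i) == 0%N]) (msupp v).

Lemma free_leftP v : reflect (forall m, m \in msupp v -> mleft m = 0%MM) (free_left v).
Proof.
apply: (iffP allP) => [v0 m /v0/forallP m0|v0 m /v0 m0].
  by apply/mnmP => i; rewrite mnmE mnm0E; apply/eqP.
by apply/forallP => i; move/mnmP/(_ i): m0; rewrite mnmE mnm0E => ->.
Qed.

Lemma iota_uncat v : free_left v -> iota (uncat v) = v.
Proof.
move/free_leftP=> v0; rewrite [RHS]mpolyE raddf_sum /= big_seq [RHS]big_seq.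
apply: eq_bigr => m m_v; rewrite iotaE.
have [->|vm0] := eqVneq v@_m 0; first by rewrite !scale0r msupp0 big_nil.
have Dm := mcatK m; rewrite (v0 m m_v) in Dm.
by rewrite msuppMCX // big_seq1 mcoeffZ mcoeffX eqxx mulr1 Dm.
Qed.

Lemma elim_partP G w : w \in elim_part G <-> iota w \in G.
Proof.
split=> [/mapP[v]|wG].
  by rewrite mem_filter => /andP[v0 vG] ->; rewrite -[\sum_(_ <- _) _]/(uncat v) iota_uncat.
have w0 : free_left (iota w).
  apply/free_leftP => m; rewrite mcoeff_msupp iota_coef.
  by case: ifP => [/eqP //|_]; rewrite eqxx.
have Dw : uncat (iota w) = w by apply: iota_inj; rewrite iota_uncat.
by rewrite -Dw; apply: map_f; rewrite mem_filter wG andbT.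
Qed.

(** An element of G whose leading monomial divides one free of the first block is, by the
    elimination order, entirely free of that block, so it comes from [elim_part]. *)
Lemma elim_groebner (J : {mpoly C[(a + b)%N]} -> Prop) G :
  groebner le J G -> groebner le_r (fun w => J (iota w)) (elim_part G).
Proof.
move=> gJ; apply: comb_groebner => [w /elim_partP/(proj1 gJ)[w0 Jw]|w Jw w0].
  by split=> //; apply: contraNneq w0 => ->; rewrite rmorph0.
have iw0 : iota w != 0 by apply: contra_neq w0 => iw0; apply: iota_inj; rewrite iw0 rmorph0.
have [wLM wLC] := LM_iota w0; have [c [le_c Dc]] := groebner_comb gJ Jw iw0.
apply: (ideal_LT_comb (le := le_r)); set L := map _ _.
have idL : is_ideal (ideal_of L) := ideal_of_ideal L.
rewrite -wLC Dc scaler_suml; apply: ideal_sum => // i _.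
have [->|/le_c] := eqVneq (c i) 0; first by rewrite mul0r scale0r; apply: ideal0.
set g := G`_i; have gG : g \in G by apply: mem_nth.
have [g0 _] := proj1 gJ _ gG; rewrite wLM -[X in (X <= _)%MM]mcatK lem_mcat => /andP[].
rewrite lem_m0 => /eqP g_l le_gw.
have [w' Dg] : exists w', g = iota w'.
  exists (uncat g); rewrite iota_uncat //; apply/free_leftP => m /(LM_max le_mo).
  move/(elim_le_left le_mo le_elim); rewrite g_l => le_m0.
  by apply: (mo_anti (order_l_mo le_mo)); rewrite le_m0 (mo_ge0 (order_l_mo le_mo)).
have w'0 : w' != 0 by apply: contra_neq g0 => w'0; rewrite Dg w'0 rmorph0.
have [LMg LCg] := LM_iota w'0; rewrite Dg LMg mright_mcat in le_gw.
rewrite Dg LCg -(submK le_gw) mpolyXD -scalerA scalerAr scalerAl.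
apply: (idealM idL); apply/ideal_of_mem/map_f; apply/elim_partP.
by rewrite -Dg.
Qed.

End Elimination.

(** * Intersection of two ideals by a tag variable *)

Section TagVariable.

Variables (C : comNzRingType) (r a b : nat).
Variables (u : 'I_a -> {mpoly C[r]}) (v : 'I_b -> {mpoly C[r]}).
Notation iota := (@mrename _ _ C (@rshift 1 r)).
Let z : {mpoly C[(1 + r)%N]} := 'X_(lshift r ord0).

Definition tag_gens : seq {mpoly C[(1 + r)%N]} :=
  [seq z * iota (u i) | i <- enum 'I_a] ++ [seq (1 - z) * iota (v j) | j <- enum 'I_b].

Definition subst_tag (c : {mpoly C[r]}) : (1 + r).-tuple {mpoly C[r]} :=
  [tuple match split i with inl _ => c | inr j => 'X_j end | i < (1 + r)%N].

Lemma subst_tag_iota c w : iota w \mPo subst_tag c = w.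
Proof.
rewrite comp_mrename -[RHS]comp_mpoly_id; congr comp_mpoly.
by apply: eq_mktuple => i; rewrite tnth_mktuple (unsplitK (inr i)).
Qed.

Lemma subst_tag_z c : z \mPo subst_tag c = c.
Proof. by rewrite comp_mpolyXi tnth_mktuple (unsplitK (inl ord0)). Qed.

(** Setting z = 1 kills the second family and leaves the u_i; setting z = 0 kills the first and
    leaves the v_j. Conversely w = z w + (1 - z) w. *)
Lemma ideal_tag_gens w : ideal_of tag_gens (iota w) <->
  ideal_of (codom u) w /\ ideal_of (codom v) w.
Proof.
have idT := ideal_of_ideal tag_gens.
have idU := ideal_of_ideal (codom u); have idV := ideal_of_ideal (codom v).
split=> [Tw|[Uw Vw]].
  split; [rewrite -(subst_tag_iota 1 w) | rewrite -(subst_tag_iota 0 w)].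
    apply: (ideal_of_min (J := fun x => ideal_of (codom u) (x \mPo subst_tag 1))) Tw.
      exact: ideal_preim idU.
    move=> x; rewrite mem_cat => /orP[] /mapP[i _ ->]; rewrite rmorphM /= subst_tag_iota.
      by apply: (idealM idU); apply: ideal_of_mem; apply: codom_f.
    by rewrite rmorphB rmorph1 /= subst_tag_z subrr mul0r; apply: ideal0.
  apply: (ideal_of_min (J := fun x => ideal_of (codom v) (x \mPo subst_tag 0))) Tw.
    exact: ideal_preim idV.
  move=> x; rewrite mem_cat => /orP[] /mapP[i _ ->]; rewrite rmorphM /= subst_tag_iota.
    by rewrite subst_tag_z mul0r; apply: ideal0.
  by apply: (idealM idV); apply: ideal_of_mem; apply: codom_f.
have -> : iota w = z * iota w + (1 - z) * iota w by rewrite -mulrDl addrC subrK mul1r.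
have idM x : is_ideal (fun w => ideal_of tag_gens (x * iota w)).
  split=> [|w1 w2|c w1]; first by rewrite rmorph0 mulr0; apply: ideal0.
    by rewrite rmorphD mulrDr; apply: idealD.
  by rewrite rmorphM mulrCA; apply: idealM.
apply: (idealD idT).
  apply: (ideal_of_min (idM z)) Uw => _ /codomP[i ->].
  by apply: ideal_of_mem; rewrite mem_cat (map_f (fun i => z * iota (u i))) ?mem_enum.
apply: (ideal_of_min (idM (1 - z))) Vw => _ /codomP[i ->].
by apply: ideal_of_mem; rewrite mem_cat (map_f (fun i => (1 - z) * iota (v i))) ?mem_enum ?orbT.
Qed.

End TagVariable.

(** * Kernel of an algebra morphism by the ideal of its graph *)

Section GraphIdeal.

Variables (C : comNzRingType) (r k : nat) (u : k.-tuple {mpoly C[r]}).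
Notation iota := (@mrename _ _ C (@rshift r k)).
Notation lambda := (@mrename _ _ C (@lshift r k)).

Definition graph_gens : seq {mpoly C[(r + k)%N]} :=
  [seq 'X_(rshift r i) - lambda (tnth u i) | i <- enum 'I_k].

Definition subst_graph : (r + k).-tuple {mpoly C[r]} :=
  [tuple match split i with inl j => 'X_j | inr j => tnth u j end | i < (r + k)%N].

Lemma subst_graph_lambda w : lambda w \mPo subst_graph = w.
Proof.
rewrite comp_mrename -[RHS]comp_mpoly_id; congr comp_mpoly.
by apply: eq_mktuple => i; rewrite tnth_mktuple (unsplitK (inl i)).
Qed.

Lemma subst_graph_iota w : iota w \mPo subst_graph = w \mPo u.
Proof.
rewrite comp_mrename; congr comp_mpoly; apply: eq_from_tnth => i.
by rewrite !tnth_mktuple (unsplitK (inr i)).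
Qed.

(** The substitution of u_i for z_i kills the generators. Conversely [iota w] is congruent to
    [lambda (w \mPo u)] modulo them. *)
Lemma ideal_graph_gens w : ideal_of graph_gens (iota w) <-> w \mPo u = 0.
Proof.
have idT := ideal_of_ideal graph_gens; split=> [Tw|w0].
  rewrite -subst_graph_iota.
  apply: (ideal_of_min (J := fun x => x \mPo subst_graph = 0)) Tw.
    split=> [|x y x0 y0|c x x0]; first exact: rmorph0.
      by rewrite rmorphD /= x0 y0 addr0.
    by rewrite rmorphM /= x0 mulr0.
  move=> _ /mapP[i _ ->]; rewrite rmorphB /= subst_graph_lambda comp_mpolyXi.
  by rewrite tnth_mktuple (unsplitK (inr i)) subrr.
rewrite -[iota w]subr0 -(rmorph0 lambda) -w0.
apply: (mmorph_congr (f := mrename (@rshift r k)) (g := lambda \o comp_mpoly u)) => // [c|i] /=.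
  by rewrite mrenameC comp_mpolyC mrenameC.
rewrite mrenameX comp_mpolyXi; apply: ideal_of_mem.
by apply: (map_f (fun i => 'X_(rshift r i) - lambda (tnth u i))); rewrite mem_enum.
Qed.

End GraphIdeal.

(** Serves to discard the images of f and q in A. *)
Lemma ideal_of_cat0 (C : comNzRingType) (s s' : seq C) x :
  (forall y, y \in s' -> y = 0) -> ideal_of (s ++ s') x <-> ideal_of s x.
Proof.
move=> s'0; split; apply: ideal_of_sub => y; last first.
  by move=> ys; apply: ideal_of_mem; rewrite mem_cat ys.
rewrite mem_cat => /orP[/ideal_of_mem //|/s'0->].
exact: ideal0 (ideal_of_ideal _).
Qed.

Lemma codom_ord1 (T : Type) (f : 'I_1 -> T) : codom f = [:: f ord0].
Proof.
rewrite codomE; case: (enum 'I_1) (size_enum_ord 1) => [|i []] //= _.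
by rewrite (ord1 i).
Qed.

(** * Ideal quotients by principal ideals *)

Section Colon.

Variables (C : comNzRingType).

Lemma ideal_setI (J1 J2 : C -> Prop) : is_ideal J1 -> is_ideal J2 ->
  is_ideal (fun x => J1 x /\ J2 x).
Proof.
move=> id1 id2; split; first by split; apply: ideal0.
- by move=> a b [? ?] [? ?]; split; apply: idealD.
- by move=> c a [? ?]; split; apply: idealM.
Qed.

Lemma colon_codom b (J1 : C -> Prop) (v : 'I_b -> C) w : is_ideal J1 ->
  colon J1 (ideal_of (codom v)) w <-> forall j, colon J1 (ideal_of [:: v j]) w.
Proof.
move=> id1; split=> [Jw j x /ideal_of1P[c ->]|Jw].
  by apply: Jw; apply: (idealM (ideal_of_ideal _)); apply/ideal_of_mem/codom_f.
apply: ideal_of_min => [|_ /codomP[j ->]].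
  split=> [|x y Jx Jy|c x Jx]; first by rewrite mulr0; apply: ideal0.
    by rewrite mulrDr; apply: idealD.
  by rewrite mulrCA; apply: idealM.
by apply: (Jw j); apply: ideal_of_mem; rewrite inE.
Qed.

(** A product c v determines c only modulo the annihilator of v. If w v is a combination of the Q_i
    v, then w differs from the same combination of the Q_i by an annihilator of v. *)
Lemma colon_principal (J1 : C -> Prop) v (W Q : seq C) : is_ideal J1 ->
  (forall w, J1 w /\ ideal_of [:: v] w <-> ideal_of W w) ->
  [seq c * v | c <- Q] = W ->
  forall w, colon J1 (ideal_of [:: v]) w <-> ideal_gen (fun c => c \in Q \/ c * v = 0) w.
Proof.
move=> id1 JW DW w; have idQ := ideal_gen_ideal (fun c => c \in Q \/ c * v = 0); split.
  move=> Jw; have : J1 (w * v) /\ ideal_of [:: v] (w * v).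
    split; first by apply: Jw; apply: ideal_of_mem; rewrite inE.
    by apply/ideal_of1P; exists w.
  move/JW; rewrite -DW => /ideal_ofP[]; rewrite size_map => c Dwv.
  rewrite -[w](subrK (\sum_i c i * Q`_i)); apply: (idealD idQ).
    apply: ideal_gen_mem; right; rewrite mulrBl Dwv mulr_suml -sumrB big1 // => i _.
    by rewrite (nth_map 0) // mulrA subrr.
  apply: ideal_sum => // i _; apply: (idealM idQ); apply: ideal_gen_mem.
  by left; apply: mem_nth.
apply: (ideal_gen_min (J := colon J1 (ideal_of [:: v]))).
  split=> [x _|x y Jx Jy t Jt|c x Jx t Jt]; first by rewrite mul0r; apply: ideal0.
    by rewrite mulrDl; apply: idealD => //; [apply: Jx | apply: Jy].
  by rewrite -mulrA; apply: idealM => //; apply: Jx.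
move=> x Qx y /ideal_of1P[c ->]; rewrite mulrCA; apply: idealM => //.
case: Qx => [xQ|->]; last exact: ideal0.
by apply: (proj1 ((JW _).2 _)); apply: ideal_of_mem; rewrite -DW (map_f (fun c => c * v)).
Qed.

Lemma principal_quotients v (W : seq C) : (forall w, w \in W -> ideal_of [:: v] w) ->
  exists Q, [seq c * v | c <- Q] = W.
Proof.
elim: W => [|w W IH] vW; first by exists [::].
have [|Q <-] := IH; first by move=> x xW; apply: vW; rewrite inE xW orbT.
have /ideal_of1P[c ->] : ideal_of [:: v] w by apply: vW; rewrite inE eqxx.
by exists (c :: Q).
Qed.

End Colon.

(** * Images in A of the ideals built in T *)

Section Bridge.

Variables (q : nat) (fhat : {poly 'Z_q}).
Hypotheses (q_gt1 : (1 < q)%N) (fhat_monic : fhat \is monic).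
Hypothesis fhat_gt1 : (1 < size fhat)%N.
Notation pi := (@phipsi q _ fhat).

Lemma phiX r m : phi fhat ('X_[m] : {mpoly {poly 'Z_q}[r]}) = 'X_[m].
Proof. exact: map_mpolyX. Qed.

Lemma phiZ r c (v : {mpoly {poly 'Z_q}[r]}) : phi fhat (c *: v) = in_qpoly fhat c *: phi fhat v.
Proof. exact: map_mpolyZ. Qed.

Lemma phipsiXl r (i : 'I_r) : pi ('X_(lshift 1 i) : Zyx r) = 'X_i.
Proof.
rewrite /phipsi psiX mnm1E eq_lrshift expr0 scale1r phiX.
by congr 'X_[_]; apply/mnmP => j; rewrite mnmE !mnm1E eq_lshift.
Qed.

Lemma phipsiXr r : pi ('X_(rshift r ord0) : Zyx r) = (in_qpoly fhat 'X)%:MP.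
Proof.
rewrite /phipsi psiX mnm1E eqxx expr1 phiZ phiX -[RHS]mulr1 mul_mpolyC -mpolyX0.
by congr (_ *: 'X_[_]); apply/mnmP => j; rewrite mnmE mnm0E mnm1E eq_rlshift.
Qed.

Lemma phipsi_embedT r r' (s : 'I_r -> 'I_r') g : pi (embedT s g) = mrename s (pi g).
Proof.
apply: (mmorph_ext (f := @phipsi q r' fhat \o embedT s)
  (g := mrename s \o @phipsi q r fhat)) => [c|i].
  have -> : c%:MP = c%:~R :> Zyx r by rewrite -[c in LHS]intz rmorph_int.
  by rewrite !rmorph_int.
rewrite /= /embedT mrenameX; case: (split_ordP i) => j ->.
  by rewrite phipsiXl phipsiXl mrenameX.
by rewrite (ord1 j) phipsiXr phipsiXr mrenameC.
Qed.

Lemma phipsi_embed_rep r r' (s : 'I_r -> 'I_r') uh ub : represents uh ub ->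
  pi (embedT s (liftZ uh)) = mrename s (ub : {mpoly {poly %/ fhat}[r]}).
Proof. by case=> <- _; rewrite [LHS]phipsi_embedT phipsi_liftZ. Qed.

Lemma phipsi_input r t (fh : 'I_t -> {mpoly {poly 'Z_q}[r]})
    (fb : 'I_t -> {mpoly {poly %/ fhat}[r]}) g :
  (forall i, represents (fh i) (fb i)) ->
  ideal_of (input_set fhat fh) g <-> ideal_of (codom fb) (pi g).
Proof.
move=> rep_f; apply: iff_trans (ideal_of_phipsi q_gt1 fhat_monic fhat_gt1 _ _) _.
  by move=> x; rewrite mem_cat orbC => ->.
rewrite map_cat; apply: iff_trans (@ideal_of_cat0 _ _ _ _ _) _.
  by move=> x /mapP[y /(phipsi_moduli q_gt1 fhat_monic fhat_gt1) y0 ->].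
rewrite -map_comp codomE (eq_map (g := fb)) // => i.
by rewrite /= phipsi_liftZ //; case: (rep_f i).
Qed.

Lemma phipsi_inter_gens r a b uh vh (ub : 'I_a -> {mpoly {poly %/ fhat}[r]}) (vb : 'I_b -> _) g :
  (forall i, represents (uh i) (ub i)) -> (forall i, represents (vh i) (vb i)) ->
  ideal_of (inter_gens fhat uh vh) g <-> ideal_of (tag_gens ub vb) (pi g).
Proof.
move=> rep_u rep_v; apply: iff_trans (ideal_of_phipsi q_gt1 fhat_monic fhat_gt1 _ _) _.
  by move=> x xM; rewrite !mem_cat xM !orbT.
rewrite /inter_gens catA map_cat; apply: iff_trans (@ideal_of_cat0 _ _ _ _ _) _.
  by move=> x /mapP[y /(phipsi_moduli q_gt1 fhat_monic fhat_gt1) y0 ->].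
rewrite map_cat -[map _ (map _ (enum 'I_a))]map_comp -[map _ (map _ (enum 'I_b))]map_comp /tag_gens.
set s1 := map _ _; set s2 := map _ _; set s3 := map _ _; set s4 := map _ _.
have -> : s1 = s3.
  apply: eq_map => i; rewrite [LHS]rmorphM; congr (_ * _); first exact: phipsiXl.
  exact: phipsi_embed_rep.
have -> // : s2 = s4.
apply: eq_map => i; rewrite [LHS]rmorphM rmorphB rmorph1; congr ((1 - _) * _).
  exact: phipsiXl.
exact: phipsi_embed_rep.
Qed.

Lemma phipsi_ker_gens r k uh (ub : k.-tuple {mpoly {poly %/ fhat}[r]}) g :
  (forall i, represents (uh i) (tnth ub i)) ->
  ideal_of (ker_gens fhat uh) g <-> ideal_of (graph_gens ub) (pi g).
Proof.
move=> rep_u; apply: iff_trans (ideal_of_phipsi q_gt1 fhat_monic fhat_gt1 _ _) _.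
  by move=> x xM; rewrite !mem_cat xM !orbT.
rewrite map_cat; apply: iff_trans (@ideal_of_cat0 _ _ _ _ _) _.
  by move=> x /mapP[y /(phipsi_moduli q_gt1 fhat_monic fhat_gt1) y0 ->].
rewrite -[map _ (map _ (enum 'I_k))]map_comp /graph_gens; set s1 := map _ _; set s2 := map _ _.
have -> // : s1 = s2.
apply: eq_map => i; rewrite [LHS]rmorphB; congr (_ - _); first exact: phipsiXl.
exact: phipsi_embed_rep.
Qed.

(** As J is the full preimage of Jb under a surjection, the induced map from T/J to A/Jb is a
    bijection on cosets. *)
Lemma complete_reps_bar r (J D : Zyx r -> Prop) (Jb : {mpoly {poly %/ fhat}[r]} -> Prop) :
  (forall g, J g <-> Jb (pi g)) ->
  complete_reps J D -> complete_reps Jb (fun w => exists2 c, D c & w = pi c).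
Proof.
have piB x y : pi (x - y) = pi x - pi y := rmorphB (@phipsi q r fhat) x y.
move=> J_Jb reps w; have [v <-] := phipsi_surj w.
have [c [[Dc Jvc] c_uniq]] := reps v; exists (pi c); split.
  by split; [exists c | rewrite -piB; apply/J_Jb].
by move=> _ [[c' Dc' ->]]; rewrite -piB => /J_Jb Jvc'; rewrite (c_uniq c').
Qed.

End Bridge.

(** * Syzygies *)

Section ModuleSpan.

Variables (C : comNzRingType) (k : nat).
Implicit Types (S : 'rV[C]_k -> Prop) (v : 'rV[C]_k).

Lemma mod_span0 S : mod_span S 0.
Proof. by exists [::]; rewrite big_nil. Qed.

Lemma mod_spanD S v1 v2 : mod_span S v1 -> mod_span S v2 -> mod_span S (v1 + v2).
Proof.
move=> [s1 [S1 ->]] [s2 [S2 ->]]; exists (s1 ++ s2).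
by rewrite big_cat; split=> // c; rewrite mem_cat => /orP[/S1|/S2].
Qed.

Lemma mod_spanZ S c v : mod_span S v -> mod_span S (c *: v).
Proof.
move=> [s [Ss ->]]; exists [seq (c * d.1, d.2) | d <- s].
rewrite big_map scaler_sumr; split=> [d /mapP[e /Ss ? ->] //|].
by apply: eq_bigr => d _; rewrite scalerA.
Qed.

Lemma mod_span_mem S v : S v -> mod_span S v.
Proof.
move=> Sv; exists [:: (1, v)]; rewrite big_seq1 scale1r; split=> // c.
by rewrite inE => /eqP->.
Qed.

Lemma mod_span_sum S (I : Type) (s : seq I) (P : pred I) F :
  (forall i, P i -> mod_span S (F i)) -> mod_span S (\sum_(i <- s | P i) F i).
Proof.
move=> SF; elim/big_ind: _ => //; first exact: mod_span0.
by move=> v1 v2; apply: mod_spanD.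
Qed.

Lemma mod_span_min S (T : 'rV[C]_k -> Prop) : T 0 ->
  (forall v1 v2, T v1 -> T v2 -> T (v1 + v2)) -> (forall c v, T v -> T (c *: v)) ->
  (forall v, S v -> T v) -> forall v, mod_span S v -> T v.
Proof.
move=> T0 TD TZ ST _ [s [Ss ->]]; rewrite big_seq_cond.
by elim/big_ind: _ => // c; rewrite andbT => /Ss/ST; apply: TZ.
Qed.

Lemma mod_span_syz S l (A : 'M[C]_(k, l)) : (forall v, S v -> v *m A = 0) ->
  forall v, mod_span S v -> v *m A = 0.
Proof.
move=> SA; apply: mod_span_min => //; first exact: mul0mx.
  by move=> v1 v2 v10 v20; rewrite mulmxDl v10 v20 addr0.
by move=> c v v0; rewrite -scalemxAl v0 scaler0.
Qed.

End ModuleSpan.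

(** * Schreyer's theorem over a commutative ring *)

Section Schreyer.

Variables (n : nat) (le : rel 'X_{1..n}) (le_mo : monomial_order le).
Variables (C : comNzRingType) (G : seq {mpoly C[n]}).
Notation rows := 'rV[{mpoly C[n]}]_(size G).
Notation LTcol := (\col_(i < size G) LT le G`_i).
Implicit Types (v h : rows) (X Y : 'X_{1..n}).

(* The i-th basis vector of the free module has degree LM G_i. *)
Definition row_le X v := forall i m, m \in msupp (v ord0 i) -> le (m + LM le G`_i)%MM X.
Definition row_lt X v := forall i m, m \in msupp (v ord0 i) -> mlt le (m + LM le G`_i)%MM X.

(** The component of degree X for this grading; it has at most one term in each coordinate. *)
Definition row_comp X v : rows :=
  \row_i (if (LM le G`_i <= X)%MM
          then (v ord0 i)@_(X - LM le G`_i)%MM *: 'X_[X - LM le G`_i] else 0).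

Lemma mul_gcol v : v *m gcol G = 0 <-> \sum_(i < size G) v ord0 i * G`_i = 0.
Proof.
split=> [/matrixP/(_ ord0 ord0)|E].
  by rewrite !mxE => E; rewrite -[RHS]E; apply: eq_bigr => i _; rewrite !mxE.
apply/matrixP => i j; rewrite !mxE -[RHS]E !ord1.
by apply: eq_bigr => l _; rewrite !mxE.
Qed.

Lemma mul_LTcol v : v *m LTcol = 0 <-> \sum_(i < size G) v ord0 i * LT le G`_i = 0.
Proof.
split=> [/matrixP/(_ ord0 ord0)|E].
  by rewrite !mxE => E; rewrite -[RHS]E; apply: eq_bigr => i _; rewrite !mxE.
apply/matrixP => i j; rewrite !mxE -[RHS]E !ord1.
by apply: eq_bigr => l _; rewrite !mxE.
Qed.

Lemma row_ltD X v1 v2 : row_lt X v1 -> row_lt X v2 -> row_lt X (v1 + v2).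
Proof.
move=> lt1 lt2 i m; rewrite mxE => /msuppD_le; rewrite mem_cat.
by case/orP; [apply: lt1 | apply: lt2].
Qed.

Lemma row_lt0 X : row_lt X 0.
Proof. by move=> i m; rewrite mxE msupp0. Qed.

Lemma mo_max (s : seq 'X_{1..n}) : s != [::] -> exists2 x, x \in s & forall y, y \in s -> le y x.
Proof.
elim: s => // a [_ _|b s /(_ isT)[x xs max_x] _].
  by exists a; rewrite ?inE // => y; rewrite inE => /eqP->; apply: mo_refl.
have [le_ax|le_xa] := orP (mo_total le_mo a x).
  exists x; first by rewrite inE xs orbT.
  by move=> y; rewrite inE => /orP[/eqP-> //|/max_x].
exists a; first by rewrite inE eqxx.
move=> y; rewrite inE => /orP[/eqP->|/max_x le_yx]; first exact: mo_refl.
exact: mo_trans le_mo _ _ _ le_yx le_xa.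
Qed.

Definition row_degrees v : seq 'X_{1..n} :=
  flatten [seq [seq (m + LM le G`_i)%MM | m <- msupp (v ord0 i)]
    | i : 'I_(size G) <- enum 'I_(size G)].

Lemma mem_row_degrees v X :
  reflect (exists (i : 'I_(size G)) m, m \in msupp (v ord0 i) /\ X = (m + LM le G`_i)%MM)
          (X \in row_degrees v).
Proof.
apply: (iffP flatten_mapP) => [[i _ /mapP[m m_v ->]]|[i [m [m_v ->]]]].
  by exists i, m.
exists i; first by rewrite mem_enum.
exact: (map_f (fun m => (m + LM le G`_i)%MM)).
Qed.

(** The second clause expresses that X is attained, in the form that makes the induction measure
    drop. *)
Lemma row_max v : v != 0 -> exists2 X, row_le X v & forall Y, row_lt Y v -> mlt le X Y.
Proof.
move=> v0; have [|X Xv max_X] := @mo_max (row_degrees v).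
  apply: contra_neq v0 => dv0; apply/rowP => i; rewrite mxE.
  apply/mpolyP => m; rewrite mcoeff0; apply: memN_msupp_eq0; apply/negP => m_v.
  suff : (m + LM le G`_i)%MM \in row_degrees v by rewrite dv0.
  by apply/mem_row_degrees; exists i, m.
exists X => [i m m_v|Y lt_Y]; first by apply: max_X; apply/mem_row_degrees; exists i, m.
by have /mem_row_degrees[i [m [m_v ->]]] := Xv; apply: lt_Y.
Qed.

Lemma row_compD X v1 v2 : row_comp X (v1 + v2) = row_comp X v1 + row_comp X v2.
Proof.
apply/rowP => i; rewrite !mxE; case: ifP => _; last by rewrite addr0.
by rewrite mcoeffD scalerDl.
Qed.

Lemma row_comp0 X : row_comp X 0 = 0.
Proof. by apply/rowP => i; rewrite !mxE mcoeff0 scale0r if_same. Qed.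

Lemma row_comp_lt X v : row_le X v -> row_lt X (v - row_comp X v).
Proof.
move=> le_X i m; rewrite mcoeff_msupp !mxE mcoeffB => ne0.
have [Dm|ne_m] := eqVneq (m + LM le G`_i)%MM X.
  by move: ne0; rewrite -Dm lem_addl addmK mcoeffZ mcoeffX eqxx mulr1 subrr eqxx.
rewrite /mlt ne_m; apply: le_X; rewrite mcoeff_msupp; apply: contra ne0 => /eqP->.
case: ifP => [le_iX|_]; last by rewrite mcoeff0 subr0.
rewrite mcoeffZ mcoeffX sub0r; case: ((X - LM le G`_i)%MM =P m) => [Dm|_].
  by rewrite -Dm submK ?eqxx in ne_m.
by rewrite mulr0 oppr0 eqxx.
Qed.

Lemma mcoeff_mulLT X f i : (f * LT le G`_i)@_X =
  if (LM le G`_i <= X)%MM then f@_(X - LM le G`_i)%MM * LC le G`_i else 0.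
Proof. exact: mcoeff_mulCX. Qed.

(** All products of the component with the leading terms are multiples of the one monomial X, so the
    syzygy condition is a single equation between coefficients. *)
Lemma row_comp_LT X v :
  row_comp X v *m LTcol = 0 <-> \sum_(i < size G) (v ord0 i * LT le G`_i)@_X = 0.
Proof.
suff E : \sum_(i < size G) row_comp X v ord0 i * LT le G`_i =
    (\sum_(i < size G) (v ord0 i * LT le G`_i)@_X) *: 'X_[X].
  split=> [/mul_LTcol|s0]; last by apply/mul_LTcol; rewrite E s0 scale0r.
  by rewrite E => /(congr1 (mcoeff X)); rewrite mcoeffZ mcoeffX eqxx mulr1 mcoeff0.
rewrite scaler_suml; apply: eq_bigr => i _; rewrite mxE mcoeff_mulLT.
case: ifP => [le_i|_]; last by rewrite mul0r scale0r.
by rewrite /LT -scalerAl -scalerAr scalerA -mpolyXD submK.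
Qed.

Lemma mul_tail_lt X Y f i : (forall m, m \in msupp f -> le (m + LM le G`_i)%MM X) ->
  supp_lt le X (f * (G`_i - LT le G`_i)).
Proof.
move=> le_f m /msuppM_le/allpairsP[[m1 m2] /= [m1f m2g ->]].
apply: mo_lt_le_trans (le_f _ m1f) => //; apply: mo_leltD => //; first exact: mo_refl.
move: m2g; rewrite mcoeff_msupp mcoeffB mcoeffZ mcoeffX.
have [<-|ne] := eqVneq (LM le G`_i) m2; first by rewrite mulr1 subrr eqxx.
rewrite mulr0 subr0 -mcoeff_msupp => /(LM_max le_mo) le2.
by rewrite /mlt eq_sym ne.
Qed.

(** In the maximal degree the tails of the G_i cannot contribute. *)
Lemma row_sum_coef X v : row_le X v ->
  (\sum_(i < size G) v ord0 i * G`_i)@_X = \sum_(i < size G) (v ord0 i * LT le G`_i)@_X.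
Proof.
move=> le_X; rewrite raddf_sum; apply: eq_bigr => i _ /=.
rewrite -[X in (_ * X)@_ _](subrK (LT le G`_i)) mulrDr mcoeffD.
rewrite [X in X + _](_ : _ = 0) ?add0r //; apply: memN_msupp_eq0; apply/negP.
by move/(mul_tail_lt X (le_X i)); rewrite mo_ltn.
Qed.

Variables (B : seq rows) (a : rows -> rows).
Hypothesis B_homog : forall h, h \in B -> homogeneous le h.
Hypothesis B_gen : forall v, v *m LTcol = 0 <-> mod_span (fun h => h \in B) v.
Hypothesis a_div : forall h, h \in B -> std_rep le (\sum_(i < size G) h ord0 i * G`_i) (a h).

(** With h homogeneous of degree Y, the component of degree X of b h comes from the single term of b
    at X - Y. The same multiple of [a h] stays below X, because the leading terms cancel in the
    combination given by h. *)
Lemma homog_comp X h b : h \in B ->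
  exists b', row_comp X (b *: h) = b' *: h /\ row_lt X (b' *: a h).
Proof.
move=> hB; have [Y homY] := B_homog hB; have [Dah le_ah] := a_div hB.
exists (if (Y <= X)%MM then b@_(X - Y)%MM *: 'X_[X - Y] else 0); split.
  apply/rowP => i; rewrite !mxE; have [->|/homY[c [u [-> <-]]]] := eqVneq (h ord0 i) 0.
    by rewrite !mulr0 mcoeff0 scale0r if_same.
  have [le_Y|nle_Y] := boolP (u + LM le G`_i <= X)%MM; last first.
    rewrite mul0r; case: ifP => // le_i; rewrite mcoeff_mulCX ifN ?scale0r //.
    apply: contra nle_Y => le_u; rewrite -(submK le_i).
    by apply/mnm_lepP => j; rewrite !mnmDE leq_add2r (mnm_lepP le_u).
  have le_i : (LM le G`_i <= X)%MM by apply: lepm_trans le_Y; apply: lem_addl.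
  have le_u : (u <= X - LM le G`_i)%MM.
    apply/mnm_lepP => j; rewrite mnmBE leq_subRL ?(mnm_lepP le_i) //.
    by rewrite addnC -mnmDE (mnm_lepP le_Y).
  rewrite le_i mcoeff_mulCX le_u submDA [(LM le _ + u)%MM]addmC.
  rewrite -scalerAl -scalerAr -mpolyXD scalerA.
  by congr (_ *: 'X_[_]); rewrite -(submK le_u) submDA [(LM le _ + u)%MM]addmC.
case: ifP => [le_Y|_]; last by rewrite scale0r; apply: row_lt0.
move=> i m; rewrite mxE => /msuppM_le/allpairsP[[m1 m2] /= [/msuppZ_le + m2a ->]].
rewrite msuppX inE => /eqP->; have a0 : a h ord0 i != 0.
  by apply: contraTneq m2a => ->; rewrite msupp0.
have [s0 le_s] := le_ah i a0; rewrite -{2}(submK le_Y) -addmA.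
apply: mo_leltD => //; first exact: mo_refl.
apply: mo_le_lt_trans (_ : mlt le (LM le (\sum_(i < size G) h ord0 i * G`_i)) Y) => //.
  by apply: mo_trans le_mo _ _ _ _ le_s; apply: mo_add (LM_max le_mo m2a).
(* The quotients in [a h] are bounded by the leading monomial of the combination they divide; since
   h is a syzygy of the leading terms, only tails remain there, and these lie below Y. *)
have /mul_LTcol hLT : h *m LTcol = 0 by apply/B_gen/mod_span_mem.
suff lt_h : supp_lt le Y (\sum_(i < size G) h ord0 i * G`_i) by apply/lt_h/LM_msupp.
have -> : \sum_(i < size G) h ord0 i * G`_i = \sum_(i < size G) h ord0 i * (G`_i - LT le G`_i).
  by under [RHS]eq_bigr do rewrite mulrBr; rewrite sumrB hLT subr0.
apply: supp_lt_sum => j _.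
have [->|/homY[c [u [-> <-]]]] := eqVneq (h ord0 j) 0.
  by rewrite mul0r; apply: supp_lt0.
apply: mul_tail_lt => // m' /msuppZ_le; rewrite msuppX inE => /eqP->.
exact: mo_refl.
Qed.

Lemma row_comp_span X v : mod_span (fun h => h \in B) v -> exists s : seq ({mpoly C[n]} * rows),
  [/\ forall c, c \in s -> c.2 \in B, row_comp X v = \sum_(c <- s) c.1 *: c.2
    & row_lt X (\sum_(c <- s) c.1 *: a c.2)].
Proof.
case=> s [sB ->]; elim: s sB => [|c s IH] sB.
  by exists [::]; rewrite !big_nil row_comp0; split=> //; apply: row_lt0.
have [|s' [s'B Ds' lt_s']] := IH; first by move=> d ds; apply: sB; rewrite inE ds orbT.
have cB : c.2 \in B by apply: sB; rewrite inE eqxx.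
have [b' [Dc lt_c]] := homog_comp X c.1 cB; exists ((b', c.2) :: s').
rewrite !big_cons row_compD Dc Ds'; split=> //; last exact: row_ltD.
by move=> d; rewrite inE => /orP[/eqP-> //|/s'B].
Qed.

Lemma sub_div_syz h : h \in B -> (h - a h) *m gcol G = 0.
Proof.
move=> /a_div[Dh _]; apply/mul_gcol.
under eq_bigr do rewrite !mxE mulrBl.
by rewrite sumrB Dh subrr.
Qed.

(* Schreyer: subtracting from a syzygy of G suitable multiples of the h - a h
   cancels its component of maximal degree. *)
Lemma schreyer v : v *m gcol G = 0 ->
  mod_span (fun w => exists2 h, h \in B & w = h - a h) v.
Proof.
have [->|v0] := eqVneq v 0; first by move=> _; apply: mod_span0.
have [X le_X _] := row_max v0; elim: (mo_wf le_mo X) v le_X {v0} => {}X _ IH v le_X vG.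
have /B_gen/(row_comp_span X)[s [sB Dc lt_s]] : row_comp X v *m LTcol = 0.
  by apply/row_comp_LT; rewrite -row_sum_coef //; move/mul_gcol: vG => ->; rewrite mcoeff0.
(* The decomposition [Dc] is one of the component of a component, hence this idempotence. *)
have comp_comp : row_comp X (row_comp X v) = row_comp X v.
  apply/rowP => i; rewrite !mxE; case: ifP => // ->.
  by rewrite mcoeffZ mcoeffX eqxx mulr1.
pose w := \sum_(c <- s) c.1 *: (c.2 - a c.2).
have Sw : mod_span (fun w => exists2 h, h \in B & w = h - a h) w.
  rewrite /w big_seq; apply: mod_span_sum => c /sB cB.
  by apply/mod_spanZ/mod_span_mem; exists c.2.
have wG : w *m gcol G = 0.
  by apply: mod_span_syz Sw => _ [h hB ->]; apply: sub_div_syz.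
rewrite -(subrK w v); apply: mod_spanD => //.
have [->|vw0] := eqVneq (v - w) 0; first exact: mod_span0.
have [Y le_Y min_Y] := row_max vw0.
apply: (IH Y) => //; last by rewrite mulmxBl vG wG subrr.
(* The top components of v and w agree up to multiples of the [a h]; both remaining parts have
   degree below X. *)
apply: min_Y; have -> : v - w = (v - row_comp X v) + \sum_(c <- s) c.1 *: a c.2.
  rewrite -comp_comp Dc /w; under [in LHS]eq_bigr do rewrite scalerBr.
  by rewrite sumrB opprB addrA [in LHS]addrAC.
by apply: row_ltD => //; apply: row_comp_lt.
Qed.

End Schreyer.

(** By the Smith normal form c = L D R, the kernel is that of D up to the change of basis L, and D
    is a column with at most its first entry nonzero. The rows of the inverse of L at the zero
    entries of D generate it. *)
Lemma int_kernel k (c : 'cV[int]_k) :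
  exists K : seq 'rV[int]_k, forall x, x *m c = 0 <-> mod_span (fun y => y \in K) x.
Proof.
have [L Lu [R Ru [d _ Dc]]] := int_Smith_normal_form c.
set D := (\matrix_(i, j) _) in Dc.
pose K := [seq row i (invmx L) | i <- enum 'I_k & D i ord0 == 0].
have KE (x : 'rV[int]_k) : x *m c = 0 <-> forall i, (x *m L) ord0 i * D i ord0 = 0.
  have -> : x *m c = 0 <-> x *m L *m D = 0.
    rewrite Dc !mulmxA; split=> [/(congr1 (mulmx^~ (invmx R)))|->]; last by rewrite mul0mx.
    by rewrite mulmxK // mul0mx.
  have D0 (i : 'I_k) : (i : nat) != 0%N -> D i ord0 = 0 by move=> i0; rewrite mxE (negPf i0).
  split=> [/matrixP/(_ ord0 ord0)|xD].
    rewrite !mxE => xD i; have [i0|/D0->] := eqVneq (i : nat) 0%N; last by rewrite mulr0.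
    rewrite (bigD1 i) //= big1 ?addr0 in xD => // j ne_ji.
    by rewrite (D0 j) ?mulr0 // -i0 val_eqE.
  by apply/matrixP => i j; rewrite !ord1 mxE big1 ?mxE.
exists K => x; split=> [/KE xD|].
  have -> : x = \sum_i (x *m L) ord0 i *: row i (invmx L) by rewrite -mulmx_sum_row mulmxK.
  apply: mod_span_sum => i _; have [Di0|Di] := eqVneq (D i ord0) 0; last first.
    have /eqP := xD i; rewrite mulf_eq0 (negPf Di) orbF => /eqP->.
    by rewrite scale0r; apply: mod_span0.
  apply/mod_spanZ/mod_span_mem/(map_f (fun i => row i (invmx L))).
  by rewrite mem_filter Di0 eqxx mem_enum.
apply: mod_span_syz => _ /mapP[i + ->]; rewrite mem_filter => /andP[/eqP Di _].
apply/KE => j; rewrite -row_mul mulVmx // row1 [X in X * _]mxE /=.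
by case: (j =P i) => [->|_]; rewrite ?Di ?mulr0 ?mul0r.
Qed.

(** * Homogeneous generators for the syzygies of leading terms over Z *)

Section TermSyzygies.

Variables (n : nat) (le : rel 'X_{1..n}) (G : seq {mpoly int[n]}).
Notation rows := 'rV[{mpoly int[n]}]_(size G).
Notation LTcol := (\col_(i < size G) LT le G`_i).
Notation e := (fun i : 'I_(size G) => LM le G`_i).
Implicit Types (v : rows) (I : {set 'I_(size G)}) (X : 'X_{1..n}).

Definition lcm_LM I : 'X_{1..n} := \big[@mlcm n/0%MM]_(i in I) e i.

Lemma lcm_LM_le I X : (lcm_LM I <= X)%MM = [forall i in I, e i <= X]%MM.
Proof.
rewrite /lcm_LM -big_andE; elim/big_rec2: _ => [|i b m _ <-]; last exact: lem_mlcm.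
by apply/mnm_lepP => j; rewrite mnm0E.
Qed.

Definition term_row I X (x : 'rV[int]_(size G)) : rows :=
  \row_i (if i \in I then x ord0 i *: 'X_[X - e i] else 0).

Lemma term_row_homog I X x : (forall i, i \in I -> e i <= X)%MM -> homogeneous le (term_row I X x).
Proof.
move=> le_X; exists X => i; rewrite mxE; case: ifP => [iI _|_]; last by rewrite eqxx.
by exists (x ord0 i), (X - e i)%MM; rewrite submK ?le_X.
Qed.

(** Kernel vectors of this column are unconstrained outside I; [term_row] discards those entries. *)
Definition LC_col I : 'cV[int]_(size G) := \col_i (if i \in I then LC le G`_i else 0).

Lemma term_row_syz I X x : (forall i, i \in I -> e i <= X)%MM ->
  (term_row I X x) *m LTcol = 0 <-> x *m LC_col I = 0.
Proof.
move=> le_X; have -> : term_row I X x *m LTcol = ((x *m LC_col I) ord0 ord0 *: 'X_[X])%:M.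
  apply/matrixP => i j; rewrite !ord1 !mxE eqxx mulr1n scaler_suml; apply: eq_bigr => l _.
  rewrite !mxE; case: ifP => [lI|_]; last by rewrite mul0r mulr0 scale0r.
  by rewrite /LT -scalerAl -scalerAr scalerA -mpolyXD submK ?le_X.
split=> [/matrixP/(_ ord0 ord0)|->]; last by rewrite mxE scale0r raddf0.
rewrite !mxE eqxx mulr1n => /(congr1 (mcoeff X)).
rewrite mcoeffZ mcoeffX eqxx mulr1 mcoeff0 => E.
by apply/matrixP => i j; rewrite !ord1 !mxE.
Qed.

(** Finitely many degrees suffice: a syzygy of degree X involves only the set I of indices whose
    leading monomial divides X, and it is a monomial multiple of the syzygy of degree [lcm_LM I]
    with the same integer coefficients. These coefficients form the kernel of [LC_col I]. *)
Lemma term_syzygies : exists B : seq rows, (forall h, h \in B -> homogeneous le h) /\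
  forall v, v *m LTcol = 0 <-> mod_span (fun h => h \in B) v.
Proof.
have [K KP] := fin_all_exists (fun I : {set 'I_(size G)} => int_kernel (LC_col I)).
have le_lcm I i : i \in I -> (e i <= lcm_LM I)%MM.
  by move=> iI; have := lepm_refl (lcm_LM I); rewrite lcm_LM_le => /forall_inP; apply.
pose B := flatten [seq [seq term_row A (lcm_LM A) x | x <- K A] | A <- enum {set 'I_(size G)}].
have memB h : h \in B -> exists I x, x \in K I /\ h = term_row I (lcm_LM I) x.
  by case/flatten_mapP => I _ /mapP[x xK ->]; exists I, x.
exists B; split=> [h /memB[I [x [_ ->]]]|v]; first by apply: term_row_homog; apply: le_lcm.
split; last first.
  apply: mod_span_syz => h /memB[I [x [xK ->]]]; apply/term_row_syz; first exact: le_lcm.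
  by apply/KP/mod_span_mem.
move=> vLT; pose s := undup (row_degrees le v).
(* Duplicates were removed from the list of degrees so that each component is counted once. *)
have -> : v = \sum_(X <- s) row_comp le X v.
  apply/rowP => i; apply/mpolyP => m; rewrite summxE raddf_sum /=.
  pose f X := if X == (m + e i)%MM then (v ord0 i)@_m else 0.
  rewrite (eq_bigr f) => [|X _]; last first.
    rewrite !mxE /f; have [->|ne] := eqVneq.
      by rewrite lem_addl addmK mcoeffZ mcoeffX eqxx mulr1.
    case: ifP => [le_X|_]; last exact: mcoeff0.
    rewrite mcoeffZ mcoeffX; case: eqP => [Dm|_]; last by rewrite mulr0.
    by rewrite -Dm submK ?eqxx in ne.
  have [m_v|m_v] := boolP (m \in msupp (v ord0 i)).
    have sm : (m + e i)%MM \in s by rewrite mem_undup; apply/mem_row_degrees; exists i, m.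
    by rewrite (bigD1_seq _ sm) ?undup_uniq //= /f eqxx big1 ?addr0 // => X /negPf->.
  rewrite big1 ?memN_msupp_eq0 // => X _.
  by rewrite /f memN_msupp_eq0 // if_same.
apply: mod_span_sum => X _; pose I := [set i | e i <= X]%MM.
have le_X i : i \in I -> (e i <= X)%MM by rewrite inE.
pose x : 'rV[int]_(size G) := \row_i (v ord0 i)@_(X - e i).
have Dv : row_comp le X v = term_row I X x by apply/rowP => i; rewrite !mxE inE.
have [s' [s'K Dx]] : mod_span (fun y => y \in K I) x.
  apply/KP/(term_row_syz _ le_X); rewrite -Dv; apply/row_comp_LT.
  by rewrite -raddf_sum; move/mul_LTcol: vLT => ->; rewrite raddf0.
have le_lcmX : (lcm_LM I <= X)%MM by rewrite lcm_LM_le; apply/forall_inP.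
have -> : row_comp le X v =
    \sum_(c <- s') (c.1 *: 'X_[X - lcm_LM I]) *: term_row I (lcm_LM I) c.2.
  rewrite Dv Dx; apply/rowP => i; rewrite mxE !summxE.
  case: ifP => [iI|iI]; last by rewrite big1 // => c _; rewrite !mxE iI mulr0.
  rewrite scaler_suml; apply: eq_bigr => c _; rewrite !mxE iI -scalerAl -scalerAr scalerA.
  rewrite -mpolyXD; congr (_ *: 'X_[_]); apply/mnmP => j.
  have /mnm_lepP/(_ j) := le_lcm _ _ iI; have /mnm_lepP/(_ j) := le_lcmX.
  by rewrite mnmDE !mnmBE => le1 le2; rewrite addnBA // subnK.
rewrite big_seq; apply: mod_span_sum => c /s'K cK; apply/mod_spanZ/mod_span_mem.
apply/flatten_mapP; exists I; first by rewrite mem_enum.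
exact: map_f.
Qed.

End TermSyzygies.

(** * Existence of the syzygy data in T *)

Section SyzygyData.

Variables (q r t : nat) (fhat : {poly 'Z_q}) (fh : 'I_t -> {mpoly {poly 'Z_q}[r]}).
Variables (le : rel 'X_{1..(r + 1)%N}) (le_mo : monomial_order le) (G : seq (Zyx r)).
Notation J := (ideal_of (input_set fhat fh)).
Notation F := (Fcol fhat fh).

Lemma Fcol_mem j : F j ord0 \in input_set fhat fh.
Proof.
rewrite mem_cat; case: (split_ordP j) => i ->.
  by rewrite col_mxEu mxE (map_f (fun i => liftZ (fh i))) ?mem_enum.
rewrite col_mxEd mxE orbC; case: i => -[|[|//]] i_lt /=; by rewrite !inE eqxx ?orbT.
Qed.

Lemma input_Fcol g : J g <-> exists c : 'rV[Zyx r]_(t + 2), (c *m F) ord0 ord0 = g.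
Proof.
have idJ := ideal_of_ideal (input_set fhat fh); split; last first.
  case=> c <-; rewrite mxE; apply: ideal_sum => // j _.
  by apply: (idealM idJ); apply/ideal_of_mem/Fcol_mem.
apply: (ideal_of_min (J := fun g => exists c : 'rV[Zyx r]_(t + 2), (c *m F) ord0 ord0 = g)).
  split.
  - by exists 0; rewrite mul0mx mxE.
  - by move=> x y [c <-] [d <-]; exists (c + d); rewrite mulmxDl mxE.
  - by move=> x y [c <-]; exists (x *: c); rewrite -scalemxAl mxE.
have Fj j : exists c : 'rV[Zyx r]_(t + 2), (c *m F) ord0 ord0 = F j ord0.
  by exists (delta_mx ord0 j); rewrite -rowE mxE.
move=> x; rewrite mem_cat => /orP[/mapP[i _ ->]|].
  by have := Fj (lshift 2 i); rewrite col_mxEu mxE.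
rewrite !inE => /orP[] /eqP->.
  by have := Fj (rshift t ord0); rewrite col_mxEd mxE.
by have := Fj (rshift t ord_max); rewrite col_mxEd mxE.
Qed.

Lemma syz_data_exists : groebner le J G -> exists B a M N, syz_data le (G := G) F B a M N.
Proof.
move=> gJ; have idJ := ideal_of_ideal (input_set fhat fh).
have [B [B_homog B_gen]] := term_syzygies le G.
have JG (i : 'I_(size G)) : J G`_i by apply: (proj1 gJ _ _).2; apply: mem_nth.
have Ea (i : 'I_(size B)) : exists a,
    std_rep le (G := G) (\sum_(j < size G) B`_i ord0 j * G`_j) a.
  apply: (groebner_std le_mo idJ gJ); apply: ideal_sum => // j _.
  exact: (idealM idJ).
have [a0 Da0] := fin_all_exists Ea.
(* Quotients are chosen per position of B; a row is sent to those of its first position, with 0 as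
   default outside B. *)
pose a h := if insub (index h B) is Some i then a0 i else 0.
have [M0 DM0] := fin_all_exists (fun i => (input_Fcol _).1 (JG i)).
have EN (j : 'I_(t + 2)) : exists c : 'rV[Zyx r]_(size G),
    F j ord0 = \sum_i c ord0 i * G`_i.
  have /(groebner_gen le_mo _ idJ gJ)/ideal_ofP[c ->] : J (F j ord0).
    exact/ideal_of_mem/Fcol_mem.
  by exists (\row_i c i); apply: eq_bigr => i _; rewrite mxE.
have [N0 DN0] := fin_all_exists EN.
exists B, a, (\matrix_i M0 i), (\matrix_j N0 j); split=> //.
- move=> h hB; rewrite /a; have lt_h : (index h B < size B)%N by rewrite index_mem.
  by rewrite insubT /=; have := Da0 (Ordinal lt_h); rewrite /= nth_index.
- apply/matrixP => i j; rewrite !ord1 !mxE -DM0 mxE; apply: eq_bigr => l _.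
  by rewrite !mxE.
apply/matrixP => i j; rewrite !ord1 DN0 !mxE; apply: eq_bigr => l _.
by rewrite !mxE.
Qed.

End SyzygyData.

(** * Passage of syzygies from T to A *)

Section SyzygyTransfer.

Variables (q r t : nat) (fhat : {poly 'Z_q}).
Hypotheses (q_gt1 : (1 < q)%N) (fhat_monic : fhat \is monic).
Hypothesis fhat_gt1 : (1 < size fhat)%N.
Variables (fh : 'I_t -> {mpoly {poly 'Z_q}[r]}) (fb : 'I_t -> {mpoly {poly %/ fhat}[r]}).
Hypothesis fh_fb : forall i, represents (fh i) (fb i).
Variables (le : rel 'X_{1..(r + 1)%N}) (le_mo : monomial_order le) (G : seq (Zyx r)).
Hypothesis gJ : groebner le (ideal_of (input_set fhat fh)) G.
Notation F := (Fcol fhat fh).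
Notation pi := (@phipsi q r fhat).
Notation fcol := (\col_i fb i).

Lemma mul_Fcol (v : 'rV[Zyx r]_(t + 2)) : (v *m F) ord0 ord0 =
  \sum_(i < t) v ord0 (lshift 2 i) * liftZ (fh i)
  + \sum_(j < 2) v ord0 (rshift t j) * (moduli r fhat)`_j.
Proof.
rewrite mxE big_split_ord; congr (_ + _); apply: eq_bigr => i _.
  by rewrite col_mxEu mxE.
by rewrite col_mxEd mxE.
Qed.

(** The two forgotten coordinates are those of f and q, which vanish in A. *)
Definition bar_row (v : 'rV[Zyx r]_(t + 2)) : 'rV[{mpoly {poly %/ fhat}[r]}]_t :=
  map_mx pi (lsubmx v).

Lemma bar_rowE v i : bar_row v ord0 i = pi (v ord0 (lshift 2 i)).
Proof. by rewrite mxE mxE. Qed.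

Lemma bar_row_Fcol v : (bar_row v *m fcol) ord0 ord0 = pi ((v *m F) ord0 ord0).
Proof.
rewrite mul_Fcol rmorphD !rmorph_sum /= [X in _ + X]big1 ?addr0 => [|j _]; last first.
  rewrite rmorphM /= [X in _ * X](_ : _ = 0) ?mulr0 //.
  by apply: (phipsi_moduli q_gt1 fhat_monic fhat_gt1); apply: mem_nth.
rewrite mxE; apply: eq_bigr => i _; rewrite bar_rowE mxE [RHS]rmorphM; congr (_ * _).
by have [<- _] := fh_fb i; rewrite [RHS]phipsi_liftZ.
Qed.

Lemma bar_row_syz v : v *m F = 0 -> bar_row v *m fcol = 0.
Proof.
move=> vF; apply/matrixP => i j; rewrite !ord1 bar_row_Fcol vF mxE mxE.
exact: rmorph0.
Qed.

Lemma bar_rowD v1 v2 : bar_row (v1 + v2) = bar_row v1 + bar_row v2.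
Proof. by rewrite /bar_row linearD; exact: (map_mxD (@phipsi q r fhat)). Qed.

Lemma bar_rowZ c v : bar_row (c *: v) = pi c *: bar_row v.
Proof. by rewrite /bar_row linearZ; exact: (map_mxZ (@phipsi q r fhat)). Qed.

Lemma bar_row_span S v : mod_span S v ->
  mod_span (fun w => exists2 u, S u & w = bar_row u) (bar_row v).
Proof.
apply: (mod_span_min (T := fun v => mod_span _ (bar_row v))).
- by rewrite -(scale0r 0) bar_rowZ rmorph0 scale0r; apply: mod_span0.
- by move=> v1 v2 S1 S2; rewrite bar_rowD; apply: mod_spanD.
- by move=> c v1 S1; rewrite bar_rowZ; apply: mod_spanZ.
by move=> u Su; apply: mod_span_mem; exists u.
Qed.

(** The coordinatewise lift of a syzygy yields an element of the kernel <f, q>; writing it in terms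
    of f and q supplies, with opposite sign, the two missing coordinates. *)
Lemma bar_row_lift (v : 'rV[{mpoly {poly %/ fhat}[r]}]_t) : v *m fcol = 0 ->
  exists2 u, u *m F = 0 & bar_row u = v.
Proof.
move=> vf; pose V : 'rV[Zyx r]_t := \row_i lift_bar (v ord0 i).
have barV w : bar_row (row_mx V w) = v.
  by apply/rowP => i; rewrite bar_rowE row_mxEl mxE phipsi_lift_bar.
have : pi ((row_mx V 0 *m F) ord0 ord0) = 0 by rewrite -bar_row_Fcol barV vf mxE.
move/(phipsi_eq0 q_gt1 fhat_monic fhat_gt1)/ideal_ofP => [c Dc].
exists (row_mx V (- \row_j c j)) => //.
apply/matrixP => i j; rewrite !ord1 [RHS]mxE.
have -> : row_mx V (- \row_j c j) = row_mx V 0 - row_mx 0 (\row_j c j).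
  by rewrite opp_row_mx oppr0 add_row_mx addr0 add0r.
rewrite mulmxBl [LHS]mxE [X in _ + X]mxE Dc mul_Fcol.
rewrite [X in _ - (X + _)]big1 ?add0r => [|l _]; last first.
  by rewrite row_mxEl mxE mul0r.
apply/eqP; rewrite subr_eq0; apply/eqP; apply: eq_bigr => l _.
by rewrite row_mxEr mxE.
Qed.

Lemma syz_transfer B a M N : syz_data le (G := G) F B a M N ->
  forall v, v *m fcol = 0 <-> mod_span (fun w => w \in syz_gens fhat B a M N) v.
Proof.
move=> data v; have [B_homog B_gen a_div DM DN] := data; split.
  case/bar_row_lift=> u uF <-.
  have Sy : mod_span (fun w => w \in [seq (h - a h) *m M | h <- B]
      ++ [seq row i (1%:M - N *m M) | i <- enum 'I_(t + 2)%N]) u.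
    (* As F = N G, the row u N is a syzygy of G, to which Schreyer's theorem applies; the other
       summand is a combination of the rows of 1 - N M. *)
    have -> : u = u *m (1%:M - N *m M) + u *m N *m M.
      by rewrite mulmxBr mulmx1 mulmxA subrK.
    apply: mod_spanD.
      rewrite mulmx_sum_row; apply: mod_span_sum => i _; apply/mod_spanZ/mod_span_mem.
      by rewrite mem_cat (map_f (fun i => row i (1%:M - N *m M))) ?mem_enum ?orbT.
    have : u *m N *m gcol G = 0 by rewrite -mulmxA -DN.
    move/(schreyer le_mo B_homog B_gen a_div).
    apply: (mod_span_min (T := fun w => mod_span _ (w *m M))).
    - by rewrite mul0mx; apply: mod_span0.
    - by move=> w1 w2 S1 S2; rewrite mulmxDl; apply: mod_spanD.
    - by move=> c w S1; rewrite -scalemxAl; apply: mod_spanZ.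
    move=> _ [h hB ->]; apply: mod_span_mem.
    by rewrite mem_cat (map_f (fun h => (h - a h) *m M)).
  move/bar_row_span: Sy; apply: mod_span_min; first exact: mod_span0.
  - by move=> w1 w2; apply: mod_spanD.
  - by move=> c w; apply: mod_spanZ.
  move=> _ [w Sw ->]; apply: mod_span_mem; exact: (map_f (fun v => map_mx pi (lsubmx v))).
apply: mod_span_syz => _ /mapP[w Sw ->]; apply: bar_row_syz.
move: Sw; rewrite mem_cat => /orP[/mapP[h hB ->]|/mapP[i _ ->]].
  by rewrite -mulmxA -DM; apply: sub_div_syz a_div _ hB.
by rewrite -row_mul mulmxBl mul1mx -mulmxA -DM -DN subrr row0.
Qed.

End SyzygyTransfer.

Theorem theorem6p1 (p m n r t : nat) (p_pr : prime p)
    (m_gt0 : (0 < m)%N) (n_gt0 : (0 < n)%N)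
    (fhat : {poly 'Z_(p ^ n)}) (fhat_monic : fhat \is monic)
    (fhat_deg : size fhat = m.+1)
    (fhat_irr : irreducible_poly (red_mod_p fhat))
    (fbar : 'I_t -> {mpoly {poly %/ fhat}[r]})
    (fh : 'I_t -> {mpoly {poly 'Z_(p ^ n)}[r]})
    (fbar_neq0 : forall i, fbar i != 0)
    (fh_fbar : forall i, represents (fh i) (fbar i))
    (le : rel 'X_{1..(r + 1)%N})
    (le_mo : monomial_order le) (le_elim : elim_order le)
    (G : seq (Zyx r))
    (G_strong : strong_groebner le (ideal_of (input_set fhat fh)) G)
    (G_alg : spoly_output le (input_set fhat fh) G) :
  let q := (p ^ n)%N in
  let J : Zyx r -> Prop := ideal_of (input_set fhat fh) in
  let Jbar : {mpoly {poly %/ fhat}[r]} -> Prop := ideal_of (codom fbar) in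
  (* Groebner basis of Jbar *)
  ((forall v, (v \in [seq phipsi fhat g | g <- G & g \notin moduli r fhat])
              = (v \in bar_set fhat G))
   /\ groebner (order_l le) Jbar (bar_set fhat G))
  /\
  (* splitting of psi(g) modulo fhat *)
  (forall g, g \in G -> g \notin moduli r fhat ->
     let v := psi q g in
     let v' := split_out fhat v in
     let v'' := split_in fhat v in
     [/\ v = v' + v'',
         forall a, a \in msupp v' -> ~ ideal_of [:: fhat] v'@_a,
         forall a, a \in msupp v'' -> ideal_of [:: fhat] v''@_a,
         phipsi fhat g = phi fhat v'
         /\ phi fhat v' = \sum_(a <- msupp v') in_qpoly fhat v'@_a *: 'X_[a]
       & forall a, a \in msupp v' -> in_qpoly fhat v'@_a != 0])
  /\
  (* ideal membership *)
  (forall (ubar : {mpoly {poly %/ fhat}[r]}) (uh : {mpoly {poly 'Z_(p ^ n)}[r]}),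
     ubar != 0 -> represents uh ubar ->
     let u := liftZ uh in
     [/\ Jbar ubar <-> J u,
         J u <-> red_star le G u 0
       & J u <-> exists H : 'rV[Zyx r]_(size G), std_rep le u H])
  /\
  (* coset representatives *)
  ((forall D : Zyx r -> Prop, complete_reps J D ->
      complete_reps Jbar (fun w => exists2 c, D c & w = phipsi fhat c))
   /\ (forall rep : seq int -> int -> int, effective_reps rep ->
        complete_reps J (totally_reduced le rep G)
        /\ complete_reps Jbar
             (fun w => exists2 c, totally_reduced le rep G c & w = phipsi fhat c)))
  /\
  (* elimination: Z[y, z, x] and R[z, x] with k variables z and r variables x *)
  (forall (k t' : nat)
     (fbar' : 'I_t' -> {mpoly {poly %/ fhat}[(k + r)%N]})
     (fh' : 'I_t' -> {mpoly {poly 'Z_(p ^ n)}[(k + r)%N]})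
     (le' : rel 'X_{1..(k + r + 1)%N}) (G' : seq (Zyx (k + r))),
     (forall i, fbar' i != 0) ->
     (forall i, represents (fh' i) (fbar' i)) ->
     monomial_order le' -> elim_order le' ->
     elim_order (order_l le' : rel 'X_{1..(k + r)%N}) ->
     strong_groebner le' (ideal_of (input_set fhat fh')) G' ->
     spoly_output le' (input_set fhat fh') G' ->
     groebner (order_r (order_l le' : rel 'X_{1..(k + r)%N}))
       (fun w => ideal_of (codom fbar') (mrename (@rshift k r) w))
       (elim_part (bar_set fhat G' : seq {mpoly {poly %/ fhat}[(k + r)%N]})))
  /\
  (* intersections and quotients: Z[y, z, x] with one variable z *)
  (forall (a b : nat)
     (ubar : 'I_a -> {mpoly {poly %/ fhat}[r]})
     (uh : 'I_a -> {mpoly {poly 'Z_(p ^ n)}[r]})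
     (vbar : 'I_b -> {mpoly {poly %/ fhat}[r]})
     (vh : 'I_b -> {mpoly {poly 'Z_(p ^ n)}[r]})
     (le' : rel 'X_{1..(1 + r + 1)%N}),
     (forall i, represents (uh i) (ubar i)) ->
     (forall j, represents (vh j) (vbar j)) ->
     monomial_order le' -> elim_order le' ->
     elim_order (order_l le' : rel 'X_{1..(1 + r)%N}) ->
     let J1 : {mpoly {poly %/ fhat}[r]} -> Prop := ideal_of (codom ubar) in
     let J2 : {mpoly {poly %/ fhat}[r]} -> Prop := ideal_of (codom vbar) in
     (forall H, groebner le' (ideal_of (inter_gens fhat uh vh)) H ->
        let W := elim_part
                   (bar_set fhat H : seq {mpoly {poly %/ fhat}[(1 + r)%N]}) in
        groebner (order_r (order_l le' : rel 'X_{1..(1 + r)%N}))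
          (fun w => J1 w /\ J2 w) W
        /\ (forall w, J1 w /\ J2 w <-> ideal_of W w))
     /\ (forall w, colon J1 J2 w <->
                   forall j, colon J1 (ideal_of [:: vbar j]) w)
     /\ (forall j H,
        groebner le' (ideal_of (inter_gens fhat uh (fun _ : 'I_1 => vh j))) H ->
        let W := elim_part
                   (bar_set fhat H : seq {mpoly {poly %/ fhat}[(1 + r)%N]}) in
        (forall w, J1 w /\ ideal_of [:: vbar j] w <-> ideal_of W w)
        /\ (exists Q, [seq c * vbar j | c <- Q] = W)
        /\ (forall Q, [seq c * vbar j | c <- Q] = W ->
              forall w, colon J1 (ideal_of [:: vbar j]) w <->
                        ideal_gen (fun c => c \in Q \/ c * vbar j = 0) w)))
  /\
  (* kernels: Z[y, x, z] with the x larger than the k variables z *)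
  (forall (k : nat)
     (ubar : k.-tuple {mpoly {poly %/ fhat}[r]})
     (uh : 'I_k -> {mpoly {poly 'Z_(p ^ n)}[r]})
     (le' : rel 'X_{1..(r + k + 1)%N}) (H : seq (Zyx (r + k))),
     (forall i, represents (uh i) (tnth ubar i)) ->
     monomial_order le' -> elim_order le' ->
     elim_order (order_l le' : rel 'X_{1..(r + k)%N}) ->
     groebner le' (ideal_of (ker_gens fhat uh)) H ->
     let W := elim_part
                (bar_set fhat H : seq {mpoly {poly %/ fhat}[(r + k)%N]}) in
     groebner (order_r (order_l le' : rel 'X_{1..(r + k)%N}))
       (fun w => w \mPo ubar = 0) W
     /\ (forall w, w \mPo ubar = 0 <-> ideal_of W w))
  /\
  (* syzygies *)
  ((exists B a M N, @syz_data _ le _ G _ (Fcol fhat fh) B a M N)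
   /\ (forall B a M N, @syz_data _ le _ G _ (Fcol fhat fh) B a M N ->
        forall v : 'rV[{mpoly {poly %/ fhat}[r]}]_t,
          v *m (\col_i fbar i) = 0 <->
          mod_span (fun w => w \in syz_gens fhat B a M N) v)).

Proof.
move=> q J Jbar.
have q1 : (1 < q)%N := prime_expn_gt1 p_pr n_gt0.
have f1 : (1 < size fhat)%N by rewrite fhat_deg ltnS.
have J_Jbar g : J g <-> Jbar (phipsi fhat g) := phipsi_input q1 fhat_monic f1 g fh_fbar.
have idJ : is_ideal J := ideal_of_ideal _.
have sub_in t' (fh' : 'I_t' -> {mpoly {poly 'Z_(p ^ n)}[r]}) :
    {subset moduli r fhat <= input_set fhat fh'}.
  by move=> x; rewrite mem_cat orbC => ->.
have gJ : groebner le J G := strong_groebnerW le_mo G_strong.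
have [_ G0] : {subset moduli r fhat <= G} /\
    (forall g, g \in G -> g \notin moduli r fhat -> phipsi fhat g != 0).
  have [P run _] := G_alg.
  apply: (spoly_run_ker p_pr n_gt0 fhat_monic f1 le_mo le_elim (@sub_in _ _) _ run) => g.
  rewrite mem_cat => /orP[/mapP[i _ ->] _|-> //].
  by rewrite phipsi_liftZ; have [-> _] := fh_fbar i.
(* Stated for all numbers of variables and all ideals, so as to cover J and the ideals for
   elimination, intersection and kernels alike. *)
have bar r' le' J' (Jb : {mpoly {poly %/ fhat}[r']} -> Prop) H :
    monomial_order le' -> elim_order le' -> is_ideal Jb ->
    (forall g, J' g <-> Jb (phipsi fhat g)) ->
    groebner le' J' H -> groebner (order_l le') Jb (bar_set fhat H).
  by move=> mo' elim'; apply: (bar_groebner p_pr n_gt0 fhat_monic f1 mo' elim' fhat_irr).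
split.
  split; last exact: (bar _ _ _ _ _ le_mo le_elim (ideal_of_ideal _) J_Jbar gJ).
  (* The elements other than f and q have nonzero images, whereas f and q have image 0; so both
     filters keep the same images. *)
  move=> v; apply/mapP/idP => [[g + ->]|].
    by rewrite !mem_filter => /andP[gM gG]; rewrite G0 // map_f.
  rewrite mem_filter => /andP[v0 /mapP[g gG Dv]]; exists g => //.
  rewrite mem_filter gG andbT; apply: contra v0 => /(phipsi_moduli q1 fhat_monic f1) pg0.
  by rewrite Dv pg0.
split.
  move=> g _ _ v v' v''; split.
  - exact: split_sum.
  - exact: split_out_ideal.
  - by move=> a _; apply: split_in_ideal.
  - by split; [apply: phi_split_out | apply: phiE].
  by move=> a /split_outN; rewrite in_qpoly_eq0.
split.
  move=> ubar uh ubar0 [Du _] u; split.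
  - by apply: iff_sym; apply: iff_trans (J_Jbar u) _; rewrite phipsi_liftZ Du.
  - split=> [Ju|red_u]; first exact: (strong_red0 le_mo idJ G_strong).
    apply/(red_star_ideal idJ _ red_u); last exact: ideal0.
    by move=> g /(proj1 gJ)[].
  split=> [|[H [-> _]]]; first exact: (groebner_std le_mo idJ gJ).
  apply: ideal_sum => // i _; apply: (idealM idJ).
  by apply: (proj1 gJ _ _).2; apply: mem_nth.
split.
  split=> [D|rep rep_eff]; first exact: (complete_reps_bar J_Jbar).
  have repsJ := totally_reduced_reps le_mo idJ gJ rep_eff.
  by split; last exact: (complete_reps_bar J_Jbar).
split.
  move=> k t' fbar' fh' le' G' _ rep' mo' elim' elim_zx sG' _.
  (* With y already absorbed into R, the z variables are eliminated for the restriction of the order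
     to the monomials in z and x. *)
  apply: (elim_groebner (J := ideal_of (codom fbar')) (order_l_mo mo') elim_zx).
  apply: (bar _ _ _ _ _ mo' elim' (ideal_of_ideal _) _ (strong_groebnerW mo' sG')).
  by move=> g; apply: phipsi_input.
split.
  move=> a b ubar uh vbar vh le' rep_u rep_v mo' elim' elim_zx J1 J2.
  have id1 : is_ideal J1 := ideal_of_ideal _.
  have mo_zx := order_l_mo mo'; have mo_x := order_r_mo mo_zx.
  have inter b' (vb : 'I_b' -> {mpoly {poly %/ fhat}[r]}) vh' H :
      (forall j, represents (vh' j) (vb j)) ->
      groebner le' (ideal_of (inter_gens fhat uh vh')) H ->
      groebner (order_r (order_l le' : rel 'X_{1..(1 + r)%N}))
        (fun w => J1 w /\ ideal_of (codom vb) w)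
        (elim_part (bar_set fhat H : seq {mpoly {poly %/ fhat}[(1 + r)%N]})).
    move=> rep_v' gH; apply: (groebner_equiv (ideal_tag_gens ubar vb)).
    apply: (elim_groebner (J := ideal_of (tag_gens ubar vb)) mo_zx elim_zx).
    apply: (bar _ _ _ _ _ mo' elim' (ideal_of_ideal _) _ gH).
    by move=> g; apply: phipsi_inter_gens.
  split; last split.
  - move=> H /(inter _ _ _ _ rep_v) gW W; split=> [|w]; first exact: gW.
    exact: (groebner_gen mo_x w (ideal_setI id1 (ideal_of_ideal _)) gW).
  - by move=> w; apply: colon_codom.
  move=> j H /(inter _ (fun _ : 'I_1 => vbar j) _ _ (fun _ => rep_v j)) gW W.
  have JW w : J1 w /\ ideal_of [:: vbar j] w <-> ideal_of W w.
    (* The single polynomial is viewed as a family over 'I_1, to match the intersection statement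
       for families. *)
    rewrite -[[:: vbar j]]/[:: (fun _ : 'I_1 => vbar j) ord0] -codom_ord1.
    exact: (groebner_gen mo_x w (ideal_setI id1 (ideal_of_ideal _)) gW).
  split=> //; split; last by move=> Q DW; apply: colon_principal.
  by apply: principal_quotients => w wW; apply: ((JW w).2 _).2; apply: ideal_of_mem.
split.
  move=> k ubar uh le' H rep_u mo' elim' elim_xz gH W.
  have mo_xz := order_l_mo mo'.
  have gW : groebner (order_r (order_l le' : rel 'X_{1..(r + k)%N})) (fun w => w \mPo ubar = 0) W.
    apply: (groebner_equiv (ideal_graph_gens ubar)).
    apply: (elim_groebner (J := ideal_of (graph_gens ubar)) mo_xz elim_xz).
    apply: (bar _ _ _ _ _ mo' elim' (ideal_of_ideal _) _ gH).
    by move=> g; apply: phipsi_ker_gens.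
  split=> // w; apply: (groebner_gen (order_r_mo mo_xz) w _ gW).
  split=> [|x y x0 y0|c x x0]; first exact: rmorph0.
    by rewrite rmorphD /= x0 y0 addr0.
  by rewrite rmorphM /= x0 mulr0.
split; first exact: syz_data_exists.
by move=> B a M N data v; apply: syz_transfer data v.
Qed.
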